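(* Let $(\mathcal{V},\mathcal{E})$ be a finite graph with $n$ vertices, $\tau>0$, $J_{ij}=J_{ji}>0$ for $(i,j)\in\mathcal{E}$, and consider the Gaussian free field on $(\mathbb{R}^d)^n$, $$\pi(x_1,\dots,x_n)\propto\exp\left(-\sum_{i\in\mathcal{V}}\frac{\tau}{2}|x_i|^2-\sum_{(i,j)\in\mathcal{E}}\frac{J_{ij}}{2}|x_i-x_j|^2\right).$$ Let $R\in\mathbb{R}^{n\times n}$ have entries $R_{ij}=J_{ij}/\left(\tau+\sum_{l\in\partial i}J_{il}\right)$ if $j\in\partial i$ and $R_{ij}=0$ otherwise, with lower and upper triangular parts $R_L,R_U$. Then the sequential, random-scan and parallel CAVI algorithms for $\pi$ (with one block per vertex) converge globally, i.e. from any initialisation, exponentially fast in Wasserstein-$1$ distance to the fixed point $\mu_\star=\mu_\star^1\otimes\dots\otimes\mu_\star^n$ of the CAVI updates, with rates $\rho((I_n-R_L)^{-1}R_U)$ (sequential), $\rho(\frac1nR+\frac{n-1}nI_n)$ (random scan, in expectation) and $\rho(R)$ (parallel), all strictly less than $1$. That is, for all $k\ge0$: $W_{k+1}\preceq(I_n-R_L)^{-1}R_UW_k$ (sequential), $\mathbb{E}[W_{k+1}\mid\mu_k]\preceq(\frac1nR+\frac{n-1}nI_n)W_k$ (random scan), $W_{k+1}\preceq RW_k$ (parallel).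
   Context: Edges are unordered pairs $i\ne j$, each counted once; $\partial i$ is the set of neighbours of $i$. The CAVI update of coordinate $i$ given the other factors $\nu^{-i}=(\nu^j)_{j\ne i}$ has density $\mu_\star^i[\nu^{-i}](x_i)\propto\exp\left(-\frac\tau2|x_i|^2-\sum_{j\in\partial i}\mathbb{E}_{\nu^j}\left[\frac{J_{ij}}2|x_i-X_j|^2\right]\right)$. Initial factors are absolutely continuous probability measures on $\mathbb{R}^d$ with finite first moment for which the updates are well defined. Sequential: $\mu_{k+1}^i=\mu_\star^i[\mu_{k+1}^{<i},\mu_k^{>i}]$ for $i=1,\dots,n$ in order; parallel: $\mu_{k+1}^i=\mu_\star^i[\mu_k^{-i}]$ for all $i$; random scan: draw $I$ uniformly on $\{1,\dots,n\}$ (independently across iterations), set $\mu_{k+1}^I=\mu_\star^I[\mu_k^{-I}]$ and leave the other coordinates unchanged. A fixed point satisfies $\mu_\star^i=\mu_\star^i[\mu_\star^{-i}]$ for all $i$. $\mathbb{W}_1$ is the Wasserstein-1 distance for the Euclidean metric on $\mathbb{R}^d$, $W_k=(\mathbb{W}_1(\mu_k^1,\mu_\star^1),\dots,\mathbb{W}_1(\mu_k^n,\mu_\star^n))^\top$; $\preceq$ is entrywise; $\rho(\cdot)$ is the spectral radius. *)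

(* Defs.v *)
From HB Require Import structures.
From mathcomp Require Import all_boot all_order all_algebra.
From mathcomp Require Import complex.
From mathcomp Require Import all_classical all_reals all_analysis.
From mathcomp Require Import measurable_realfun giry.

Set Implicit Arguments.
Unset Strict Implicit.
Unset Printing Implicit Defensive.

Import Order.TTheory GRing.Theory Num.Theory.
Import numFieldNormedType.Exports.

Local Open Scope classical_set_scope.
Local Open Scope ring_scope.

(* [R^d] as a measurable space: tuples carry the product (= Borel)
   sigma-algebra. *)
Notation euclid R d := (d.-tuple (measurableTypeR R)).

Section Euclid.
Context {R : realType} {d : nat}.
Implicit Types x y : euclid R d.

Definition sqnorm x : R := \sum_(c < d) tnth x c ^+ 2.
Definition enorm x : R := Num.sqrt (sqnorm x).
Definition sqdist x y : R := \sum_(c < d) (tnth x c - tnth y c) ^+ 2.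
Definition edist x y : R := Num.sqrt (sqdist x y).

End Euclid.

Lemma sigma_finite_prod (d1 d2 : measure_display) (T1 : measurableType d1)
    (T2 : measurableType d2) (R : realType)
    (m1 : {sigma_finite_measure set T1 -> \bar R})
    (m2 : {sigma_finite_measure set T2 -> \bar R}) :
  sigma_finite setT (m1 \x m2)%E.
Proof.
have /sigma_finiteP[F [TF ndF Foo]] := sigma_finiteT m1.
have /sigma_finiteP[G [TG ndG Goo]] := sigma_finiteT m2.
exists (fun k => F k `*` G k).
  rewrite -setXTT TF TG; apply/seteqP; split => [[x y] /=|[x y] [k _ []]/=].
    move=> [[i _ Fx] [j _ Gy]]; exists (maxn i j) => //; split.
      by move: x Fx; exact/subsetPset/ndF/leq_maxl.
    by move: y Gy; exact/subsetPset/ndG/leq_maxr.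
  by move=> ? ?; split; exists k.
move=> k; have [? ?] := Foo k; have [? ?] := Goo k.
split; first exact: measurableX.
by rewrite product_measure1E// lte_mul_pinfty// ge0_fin_numE.
Qed.

Section PowerMeasure.
Context {dT : measure_display} {T : measurableType dT} {R : realType}.

Section Cons.
Context {d : nat}.

Definition cons_pair (z : T * d.-tuple T) : d.+1.-tuple T :=
  [the d.+1.-tuple T of z.1 :: z.2].

Let measurable_cons_pair : measurable_fun setT cons_pair.
Proof. exact: measurable_cons. Qed.

HB.instance Definition _ := isMeasurableFun.Build _ _ _ _ cons_pair
  measurable_cons_pair.

Variables (l : {sigma_finite_measure set T -> \bar R})
  (m : {sigma_finite_measure set (d.-tuple T) -> \bar R}).

Definition cons_measure : set (d.+1.-tuple T) -> \bar R :=
  pushforward (l \x m)%E cons_pair.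

Let cons_measure0 : cons_measure set0 = 0%E.
Proof. exact: measure0. Qed.

Let cons_measure_ge0 A : (0 <= cons_measure A)%E.
Proof. exact: measure_ge0. Qed.

Let cons_measure_sigma_additive : semi_sigma_additive cons_measure.
Proof. exact: measure_semi_sigma_additive. Qed.

HB.instance Definition _ := isMeasure.Build _ _ _ cons_measure
  cons_measure0 cons_measure_ge0 cons_measure_sigma_additive.

Let cons_measure_sigma_finite : sigma_finite setT cons_measure.
Proof.
have [F FT mF] := sigma_finite_prod l m.
pose uncons (t : d.+1.-tuple T) : T * d.-tuple T :=
  (tnth t ord0, [tuple of behead t]).
have muncons : measurable_fun setT uncons.
  by apply/measurable_fun_pair;
    [exact: measurable_tnth|exact: measurable_behead].
have consK z : uncons (cons_pair z) = z.
  by case: z => a t; congr (_, _); exact/val_inj.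
exists (fun k => uncons @^-1` F k).
  by rewrite -preimage_bigcup -FT preimage_setT.
move=> k; have [mFk Fkoo] := mF k; split.
  by rewrite -[X in measurable X]setTI; exact: muncons.
rewrite /cons_measure /pushforward -comp_preimage.
by rewrite (_ : uncons \o cons_pair = id) ?preimage_id//; exact/funext.
Qed.

HB.instance Definition _ := Measure_isSigmaFinite.Build _ _ _ cons_measure
  cons_measure_sigma_finite.

End Cons.

(* The [d]-fold product of [l]; for [d = 0], the unit mass on the one-point
   space. *)
Fixpoint power_measure (l : {sigma_finite_measure set T -> \bar R}) (d : nat) :
    {sigma_finite_measure set (d.-tuple T) -> \bar R} :=
  match d with
  | 0 => \d_([tuple] : 0.-tuple T)
  | d'.+1 => cons_measure l (power_measure l d')
  end.

End PowerMeasure.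

Definition lebesgue_euclid (R : realType) (d : nat) :
    {sigma_finite_measure set (euclid R d) -> \bar R} :=
  power_measure (@lebesgue_measure R) d.

Section Wasserstein.
Context {R : realType} {d : nat}.
Implicit Types mu nu : probability (euclid R d) R.

Definition coupling mu nu
    (gamma : probability (euclid R d * euclid R d)%type R) : Prop :=
  forall A : set (euclid R d), measurable A ->
    gamma (fst @^-1` A) = mu A /\ gamma (snd @^-1` A) = nu A.

Definition wasserstein1 mu nu : \bar R :=
  ereal_inf [set \int[gamma]_z (edist z.1 z.2)%:E
            | gamma in coupling mu nu]%E.

(* The density of [mu] is a (necessarily finite and positive) multiple of [w];
   in particular the integral of [w] is positive and finite. *)
Definition has_density_propto mu (w : euclid R d -> \bar R) : Prop :=
  exists2 c : R, 0 < c & forall A, measurable A ->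
    mu A = (\int[lebesgue_euclid R d]_(x in A) (c%:E * w x))%E.

Definition admissible_factor mu : Prop :=
  mu `<< lebesgue_euclid R d /\ (\int[mu]_x (enorm x)%:E < +oo)%E.

End Wasserstein.

(* Complex eigenvalues of a real matrix; the supremum is a maximum for [n > 0]
   and [0] for [n = 0]. *)
Definition spectral_radius (R : realType) (n : nat) (M : 'M[R]_n) : R :=
  sup [set ComplexField.Normc.normc z
      | z in [set z : R[i] | eigenvalue (map_mx (real_complex R) M) z]].

(* Matrix-vector product and entrywise order for extended-real vectors, as
   Wasserstein distances are a priori in [0, +oo]. *)
Definition emulmx (R : realType) (n : nat) (M : 'M[R]_n) (w : 'I_n -> \bar R) :
    'I_n -> \bar R :=
  fun i => (\sum_(j < n) (M i j)%:E * w j)%E.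

Definition lee_vec (R : realType) (n : nat) (v w : 'I_n -> \bar R) : Prop :=
  forall i, (v i <= w i)%E.

(* Exponential convergence to [0] with asymptotic rate at most [rho]. *)
Definition converges_at_rate (R : realType) (n : nat) (rho : R)
    (W : nat -> 'I_n -> \bar R) : Prop :=
  forall r : R, rho < r ->
    exists C : R, forall k i, (W k i <= (C * r ^+ k)%:E)%E.

Section CAVI.
Context {R : realType} {n : nat} (d : nat).
Variables (tau : R) (e : rel 'I_n) (J : 'I_n -> 'I_n -> R).

(* One factor on [R^d] per vertex, standing for their product measure. *)
Local Notation factors := ('I_n -> probability (euclid R d) R).

Definition influence_mx : 'M[R]_n :=
  \matrix_(i, j) if e i j then J i j / (tau + \sum_(l | e i l) J i l) else 0.

Definition influence_lower : 'M[R]_n :=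
  \matrix_(i, j) if (j < i)%N then influence_mx i j else 0.

Definition influence_upper : 'M[R]_n :=
  \matrix_(i, j) if (i < j)%N then influence_mx i j else 0.

Definition sequential_mx : 'M[R]_n :=
  invmx (1%:M - influence_lower) *m influence_upper.

Definition random_scan_mx : 'M[R]_n :=
  n%:R^-1 *: influence_mx + ((n%:R - 1) / n%:R)%:M.

(* Minus the exponent of the update density of vertex [i]: the expectation under
   the other factors of the terms involving [x_i] in the Gaussian free field
   energy, [\sum_i tau / 2 |x_i|^2 + \sum_(edges ij) J_ij / 2 |x_i - x_j|^2].
   It may be [+oo], in which case the density vanishes. *)
Definition cavi_potential (i : 'I_n) (nu : factors) (x : euclid R d) : \bar R :=
  ((tau / 2 * sqnorm x)%:E +
   \sum_(j < n | e i j) \int[nu j]_y (J i j / 2 * sqdist x y)%:E)%E.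

(* [mu] is the update of vertex [i] given the factors [nu j], [j != i] (the
   graph has no loops, so [nu i] is not used). The relation only holds if the
   update is well defined, that is, if its density can be normalised. *)
Definition is_cavi_update (i : 'I_n) (nu : factors)
    (mu : probability (euclid R d) R) : Prop :=
  has_density_propto mu (fun x => expeR (- cavi_potential i nu x)%E).

Definition cavi_fixed_point (mu : factors) : Prop :=
  forall i, is_cavi_update i mu (mu i).

Definition sequential_cavi (mu : nat -> factors) : Prop :=
  forall k i, is_cavi_update i
    (fun j => if (j < i)%N then mu k.+1 j else mu k j) (mu k.+1 i).

Definition parallel_cavi (mu : nat -> factors) : Prop :=
  forall k i, is_cavi_update i (mu k) (mu k.+1 i).

Definition random_scan_cavi (Omega : Type) (I : nat -> Omega -> 'I_n)
    (mu0 : factors) (mu : nat -> Omega -> factors) : Prop :=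
  (forall om, mu 0%N om = mu0) /\
  forall k om,
    is_cavi_update (I k om) (mu k om) (mu k.+1 om (I k om)) /\
    forall j, j != I k om -> mu k.+1 om j = mu k om j.

Definition wasserstein_vec (mu mus : factors) : 'I_n -> \bar R :=
  fun i => wasserstein1 (mu i) (mus i).

End CAVI.

Section RandomScan.
Context {R : realType} {dO : measure_display} {Omega : measurableType dO}.
Variable P : probability Omega R.

Definition uniform_draws (n : nat) (I : nat -> Omega -> 'I_n) : Prop :=
  forall k i, measurable (I k @^-1` [set i]) /\
    P (I k @^-1` [set i]) = (n%:R^-1)%:E.

Definition independent_draws (n : nat) (I : nat -> Omega -> 'I_n) : Prop :=
  forall (s : seq nat) (B : nat -> set 'I_n), uniq s ->
    P (\bigcap_(k in [set` s]) (I k @^-1` B k)) =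
    (\prod_(k <- s) P (I k @^-1` B k))%E.

(* The sigma-algebra on [Omega] generated by a random tuple of probability
   measures, the latter being observed through the masses of measurable
   sets. *)
Definition sigma_factors (dT : measure_display) (T : measurableType dT)
    (n : nat) (X : Omega -> 'I_n -> probability T R) : set (set Omega) :=
  <<s \bigcup_(i in [set: 'I_n]) \bigcup_(A in @measurable _ T)
        preimage_set_system setT (fun om => X om i A) measurable >>.

(* [Y] is a version of the conditional expectation of the nonnegative [X]
   given the sigma-algebra [G]. *)
Definition is_cond_expectation (G : set (set Omega)) (X Y : Omega -> \bar R) :
    Prop :=
  (forall B : set (\bar R), measurable B -> G (Y @^-1` B)) /\
  forall A, G A -> (\int[P]_(om in A) Y om = \int[P]_(om in A) X om)%E.

End RandomScan.

(* Main.v *)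
From Pilot Require Import Defs.
From HB Require Import structures.
From mathcomp Require Import all_boot all_order all_algebra.
From mathcomp Require Import complex.
From mathcomp Require Import all_classical all_reals all_analysis.
From mathcomp Require Import measurable_realfun giry.
From mathcomp Require Import ring lra.

Set Implicit Arguments.
Unset Strict Implicit.
Unset Printing Implicit Defensive.

Import Order.TTheory GRing.Theory Num.Theory.
Import numFieldNormedType.Exports.

Local Open Scope classical_set_scope.
Local Open Scope ring_scope.

Local Notation edist := Pilot.Defs.edist.

(* Completing the square, a CAVI update of vertex [i] exists only if the factors
   at its neighbours have finite second moments, and it is then the Gaussian of
   precision [tau + \sum_l J i l] centred at the [R]-weighted combination of
   their means: only the means evolve. The fixed point consists of the centred
   Gaussians. An update is a translate of its fixed-point factor, so its
   Wasserstein distance to it is at most the norm of its mean, while the norm of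
   a mean is at most the distance of that factor to the centred Gaussian. Hence
   [W_i <= \sum_j R_ij W_j] after updating [i], from which the three vector
   inequalities follow. The rows of [R] sum to less than [1], which bounds the
   spectral radii, and the rates come from the growth of the powers of a matrix,
   bounded by factoring its characteristic polynomial. *)

(** * Spectral radius and growth of powers *)

Section SpectralRadius.
Variable R : realType.
Local Notation normc := (@ComplexField.Normc.normc R).

(** The random scan is the delicate case. Its trajectory is an arbitrary function of the outcome
    that satisfies the update relations, with no measurability assumed, and an update is determined
    only by its values on measurable sets. Up to that equality, however, the factors at time [k] are
    a function of the first [k] draws, so they take finitely many values and every integral is a
    finite sum over histories. Distinct histories may produce the same factors: the sigma-algebra
    generated by the factors can be strictly coarser than that of the draws, and its atoms are
    classes of histories. Each atom has positive probability, so a conditional expectation is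
    determined at every outcome. Moments need care too. An initial factor with no neighbour may have
    only a first moment; its mean then always carries the coefficient 0. Rates are stated for each
    [r] above the spectral radius, because Jordan blocks multiply the geometric decay by polynomial
    factors. *)

Lemma normc_sum (I : Type) (s : seq I) (F : I -> R[i]) :
  normc (\sum_(j <- s) F j) <= \sum_(j <- s) normc (F j).
Proof.
elim/big_ind2 : _ => [|x1 x2 y1 y2 le1 le2|//].
  by rewrite ComplexField.Normc.normc0.
exact: le_trans (le_normcD _ _) (lerD le1 le2).
Qed.

Lemma normc_ge0 (z : R[i]) : 0 <= normc z.
Proof. by case: z => a b; rewrite /normc sqrtr_ge0. Qed.

Lemma normc_real (x : R) : normc (x%:C)%C = `|x|.
Proof. by rewrite /normc /= expr0n /= addr0 sqrtr_sqr. Qed.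

(** [eigenvalue] speaks of row vectors, whereas bounds by row sums need a column eigenvector. A
    matrix and its transpose have the same rank, hence the same eigenvalues. *)
Lemma eigenvalue_col (F : fieldType) n (A : 'M[F]_n) z : eigenvalue A z ->
  exists2 v : 'cV[F]_n, v != 0 & A *m v = z *: v.
Proof.
rewrite /eigenvalue /eigenspace -mxrank_eq0 mxrank_ker subn_eq0 -ltnNge.
rewrite -mxrank_tr => lt_n.
have : eigenvalue A^T z.
  rewrite /eigenvalue /eigenspace -mxrank_eq0 mxrank_ker subn_eq0 -ltnNge.
  by rewrite -(tr_scalar_mx n z) -linearB.
case/eigenvalueP => v vA v0; exists v^T; first by rewrite trmx_eq0.
by rewrite -[A]trmxK -trmx_mul vA linearZ.
Qed.

Lemma eigenvalue_row_sum n (M : 'M[R]_n) (q : R) (z : R[i]) :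
  (forall i j, 0 <= M i j) -> (forall i, \sum_j M i j <= q) ->
  eigenvalue (map_mx (real_complex R) M) z -> normc z <= q.
Proof.
move=> M0 Mq /eigenvalue_col[v v0 Mv].
have [i0 vi0] : exists i, v i ord0 != 0.
  apply/existsP; apply: contraNT v0 => /existsPn v0; apply/eqP/matrixP => i j.
  by rewrite ord1 mxE; apply/eqP; rewrite -[_ == _]negbK v0.
(* As in Gershgorin's theorem, the eigenvalue equation is read at a coordinate of largest modulus,
   which is then divided out. *)
pose i := [arg max_(i > i0) normc (v i ord0)]%O.
have imax j : normc (v j ord0) <= normc (v i ord0).
  by rewrite /i; case: arg_maxP => // k _; exact.
have vi_gt0 : 0 < normc (v i ord0).
  apply: lt_le_trans (imax i0); rewrite lt_def normc_ge0 andbT.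
  by apply: contra_neq vi0; exact: ComplexField.Normc.eq0_normc.
rewrite -(ler_pM2r vi_gt0) -ComplexField.Normc.normcM.
have -> : z * v i ord0 = \sum_j (M i j)%:C%C * v j ord0.
  move/matrixP/(_ i ord0) : Mv; rewrite !mxE => <-.
  by apply: eq_bigr => j _; rewrite mxE.
apply: le_trans (normc_sum _ _) _.
apply: (@le_trans _ _ (\sum_j M i j * normc (v i ord0))).
  apply: ler_sum => j _; rewrite ComplexField.Normc.normcM normc_real ger0_norm
    //.
  exact: ler_wpM2l.
by rewrite -mulr_suml ler_wpM2r// normc_ge0.
Qed.

Lemma spectral_radius_row_sum n (M : 'M[R]_n) (q : R) : 0 <= q ->
  (forall i j, 0 <= M i j) -> (forall i, \sum_j M i j <= q) ->
  spectral_radius M <= q.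
Proof.
move=> q0 M0 Mq; rewrite /spectral_radius.
set S := (X in sup X).
(* With no eigenvalue, as for [n = 0], the supremum takes its default value 0; this is where
   [0 <= q] enters. *)
have [->|/set0P S0] := eqVneq S set0; first by rewrite sup0.
by apply: ge_sup => // _ [z /= zM <-]; exact: eigenvalue_row_sum zM.
Qed.

(** A supremum dominates its members only if the set is bounded above. For nonnegative entries the
    sum of all of them bounds each row sum, hence each eigenvalue. *)
Lemma normc_le_spectral_radius n (M : 'M[R]_n) (z : R[i]) :
  (forall i j, 0 <= M i j) -> eigenvalue (map_mx (real_complex R) M) z ->
  normc z <= spectral_radius M.
Proof.
move=> M0 zM; apply: ub_le_sup; last by exists z.
exists (\sum_i \sum_j M i j) => _ [y /= yM <-].
apply: eigenvalue_row_sum yM => // i.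
by rewrite [leRHS](bigD1 i)//= lerDl sumr_ge0// => k _; rewrite sumr_ge0.
Qed.

(* Dividing one root out of an annihilating polynomial turns the bound into a
   first-order recurrence [u k.+1 = z * u k + O(r ^+ k)] with [normc z < r]. *)
Lemma powers_bound n (A B : 'M[R[i]]_n.+1) (r : R) (s : seq R[i]) :
  (forall z, z \in s -> normc z < r) ->
  B * horner_mx A (\prod_(z <- s) ('X - z%:P)) = 0 ->
  exists C : R, forall k i j, normc ((B * A ^+ k) i j) <= C * r ^+ k.
Proof.
elim: s B => [|z s IHs] B sr.
  rewrite big_nil rmorph1 mulr1 => ->; exists 0 => k i j.
  by rewrite mul0r mxE ComplexField.Normc.normc0 mul0r.
rewrite big_cons rmorphM mulrA rmorphB/= horner_mx_X horner_mx_C => /IHs[].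
  by move=> y ys; rewrite sr// inE ys orbT.
move=> C hC; have zr : normc z < r by rewrite sr// mem_head.
have r0 : 0 < r by exact: le_lt_trans (normc_ge0 z) zr.
have C0 : 0 <= C.
  have := hC 0%N ord0 ord0; rewrite !expr0 !mulr1; exact/le_trans/normc_ge0.
(* The recurrence asks for [C + normc z * D <= r * D], which the first summand of [D] provides; the
   second covers [k = 0]. Here [C] comes from the induction hypothesis for [B * (A - z%:M)]. *)
pose D := C / (r - normc z) + \sum_i \sum_j normc (B i j).
exists D; elim=> [|k IHk] i j.
  rewrite !expr0 !mulr1 /D (bigD1 i)//= (bigD1 j)//= addrCA -!addrA lerDl.
  rewrite !addr_ge0 ?divr_ge0 ?subr_ge0 ?(ltW zr)//.
  - by apply: sumr_ge0 => l _; exact: normc_ge0.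
  - by apply: sumr_ge0 => l _; apply: sumr_ge0 => m _; exact: normc_ge0.
have -> : B * A ^+ k.+1 = B * (A - z%:M) * A ^+ k + z *: (B * A ^+ k).
  by rewrite mulrBr mulrBl -scalemx1 -scalerAr mulr1 -scalerAl addrNK exprS
    mulrA.
rewrite mxE [X in _ + X]mxE; apply: le_trans (le_normcD _ _) _.
rewrite ComplexField.Normc.normcM exprS mulrA.
apply: le_trans (lerD (hC _ _ _) (ler_wpM2l (normc_ge0 _) (IHk _ _))) _.
rewrite mulrA -mulrDl ler_wpM2r ?exprn_ge0 ?(ltW r0)//.
rewrite addrC -lerBrDl [_ * D]mulrC -mulrBr /D mulrDl divfK ?gt_eqF ?subr_gt0//.
rewrite lerDl mulr_ge0 ?subr_ge0 ?(ltW zr)//.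
by apply: sumr_ge0 => l _; apply: sumr_ge0 => m _; exact: normc_ge0.
Qed.

(** The characteristic polynomial splits over the complex numbers and annihilates the matrix by
    Cayley-Hamilton; its roots are the eigenvalues, all of modulus below [r]. *)
Lemma nonneg_powers_bound n (M : 'M[R]_n.+1) (r : R) :
  (forall i j, 0 <= M i j) -> spectral_radius M < r ->
  exists C : R, forall k i j, (M ^+ k) i j <= C * r ^+ k.
Proof.
move=> M0 Mr; pose A := map_mx (real_complex R) M.
have [s As] := closed_field_poly_normal (char_poly A).
have mA : lead_coef (char_poly A) = 1 by apply/monicP/char_poly_monic.
rewrite mA scale1r in As.
have [|/= |C hC] := @powers_bound n A 1 r s.
- move=> z zs; apply: le_lt_trans Mr; apply: normc_le_spectral_radius => //.
  by rewrite eigenvalue_root_char As root_prod_XsubC.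
- by rewrite -As Cayley_Hamilton mulr0.
exists C => k i j; apply: le_trans (hC k i j); rewrite mul1r.
by rewrite /A -rmorphXn/= mxE normc_real ler_norm.
Qed.

Lemma linear_recurrence_rate n (M : 'M[R]_n) (w : nat -> 'I_n -> R) (r : R) :
  (forall i j, 0 <= M i j) -> (forall i, 0 <= w 0%N i) ->
  (forall k i, w k.+1 i <= \sum_j M i j * w k j) ->
  spectral_radius M < r -> exists C : R, forall k i, w k i <= C * r ^+ k.
Proof.
(* Powers of [M] are taken in the ring of square matrices, which requires a positive size. *)
case: n M w => [|n] M w M0 w0 wM Mr; first by exists 0 => k [].
have [C hC] := nonneg_powers_bound M0 Mr.
have wpow k i : w k i <= \sum_j (M ^+ k) i j * w 0%N j.
  elim: k i => [|k IHk] i.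
    rewrite expr0 (bigD1 i)//= mxE eqxx mul1r lerDl sumr_ge0// => j ji.
    by rewrite mxE mulr_ge0// ler0n.
  apply: le_trans (wM k i) _.
  apply: (@le_trans _ _ (\sum_j M i j * \sum_l (M ^+ k) j l * w 0%N l)).
    by apply: ler_sum => j _; rewrite ler_wpM2l.
  under eq_bigr do rewrite mulr_sumr.
  rewrite exchange_big/= le_eqVlt; apply/orP; left; apply/eqP.
  apply: eq_bigr => l _; rewrite exprS mxE mulr_suml.
  by apply: eq_bigr => j _; rewrite mulrA.
exists (C * \sum_j w 0%N j) => k i; apply: le_trans (wpow k i) _.
rewrite mulrAC mulr_sumr; apply: ler_sum => j _.
by rewrite ler_wpM2r.
Qed.

End SpectralRadius.

(** * The influence matrix *)

Section InfluenceMatrix.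
Variables (R : realType) (n : nat) (tau : R) (e : rel 'I_n).
Variable J : 'I_n -> 'I_n -> R.
Hypothesis tau_gt0 : 0 < tau.
Hypothesis J_gt0 : forall i j, e i j -> 0 < J i j.

Local Notation M := (influence_mx tau e J).
Local Notation L := (influence_lower tau e J).
Local Notation U := (influence_upper tau e J).
Local Notation S := (sequential_mx tau e J).

Definition precision i : R := tau + \sum_(l | e i l) J i l.

Lemma precision_gt0 i : 0 < precision i.
Proof. by rewrite ltr_wpDr// sumr_ge0// => l /J_gt0/ltW. Qed.

Lemma influence_mx_ge0 i j : 0 <= M i j.
Proof.
rewrite mxE; case: ifP => // eij.
by rewrite divr_ge0// ?ltW ?J_gt0 ?precision_gt0.
Qed.

(** Row [i] sums to [1 - tau / precision i]. Finiteness of the vertex set yields one constant, from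
    which the bounds for all three matrices and the uniqueness of the fixed point are derived. *)
Lemma influence_mx_row_sum :
  exists q : R, [/\ 0 <= q, q < 1 & forall i, \sum_j M i j <= q].
Proof.
have row1 i : \sum_j M i j < 1.
  under eq_bigr do rewrite mxE.
  rewrite -big_mkcond/= -mulr_suml ltr_pdivrMr ?precision_gt0// mul1r.
  by rewrite ltrDr.
have row0 i : 0 <= \sum_j M i j by apply: sumr_ge0 => j _;
  exact: influence_mx_ge0.
case: n tau e J row0 row1 => [|m] t f K row0 row1.
  by exists 0; split => // -[].
pose i := [arg max_(i > ord0) \sum_j influence_mx t f K i j]%O.
exists (\sum_j influence_mx t f K i j); split => // k.
by rewrite /i; case: arg_maxP => // l _; exact.
Qed.

Lemma influence_split i (x : 'I_n -> R) :
  influence_mx tau e J i i = 0 ->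
  \sum_j M i j * x j = \sum_j L i j * x j + \sum_j U i j * x j.
Proof.
move=> Mii; rewrite -big_split/=; apply: eq_bigr => j _;
  rewrite [L _ _]mxE [U _ _]mxE.
case: ltngtP => [||/val_inj ->]; rewrite ?mul0r ?add0r ?addr0//.
by rewrite Mii mul0r.
Qed.

(** Row [i] of [L] only sees indices below [i], so strong induction applies. This is the positivity
    of the inverse of [1 - L], in a form that serves as a comparison principle without expanding
    that inverse. *)
Lemma strictly_lower_ge0 (x : 'I_n -> R) :
  (forall i, \sum_j L i j * x j <= x i) -> forall i, 0 <= x i.
Proof.
move=> Lx i; move: {2}(val i).+1 (ltnSn (val i)) => m;
  elim: m i => // m IHm i im.
apply: le_trans (Lx i); apply: sumr_ge0 => j _; rewrite [L _ _]mxE.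
case: ifPn => [ji|_]; last by rewrite mul0r.
by rewrite mulr_ge0 ?influence_mx_ge0// IHm// (leq_trans ji).
Qed.

(** [1 - L] is triangular with unit diagonal, hence invertible. Later arguments about [S] go through
    this implicit equation. *)
Lemma sequential_mxE i j : S i j = \sum_l L i l * S l j + U i j.
Proof.
have : (1%:M - L) *m S = U.
  rewrite /sequential_mx mulKVmx// unitmxE det_trig; last first.
    apply/is_trig_mxP => k l kl; rewrite !mxE ltnNge (ltnW kl)/= subr0.
    by rewrite -val_eqE/= ltn_eqF.
  rewrite big1 ?unitr1// => k _; rewrite !mxE ltnn eqxx subr0//.
rewrite mulmxBl mul1mx => /(canRL (subrK _)) /matrixP/(_ i j) ->.
by rewrite [LHS]mxE addrC [X in X + _ = _]mxE.
Qed.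

Lemma influence_upper_ge0 i j : 0 <= U i j.
Proof. by rewrite [U _ _]mxE; case: ifP => // _; exact: influence_mx_ge0. Qed.

Lemma influence_lower_ge0 i j : 0 <= L i j.
Proof. by rewrite [L _ _]mxE; case: ifP => // _; exact: influence_mx_ge0. Qed.

Lemma sequential_mx_ge0 i j : 0 <= S i j.
Proof.
apply: (@strictly_lower_ge0 (fun i => S i j)) => {}i.
by rewrite [leRHS]sequential_mxE lerDl influence_upper_ge0.
Qed.

Lemma sequential_mx_mul (y : 'I_n -> R) i :
  \sum_j S i j * y j = \sum_l L i l * (\sum_j S l j * y j) + \sum_j U i j * y j.
Proof.
under eq_bigr do rewrite sequential_mxE mulrDl.
rewrite big_split/=; congr (_ + _).
under [in RHS]eq_bigr do rewrite mulr_sumr.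
rewrite exchange_big/=; apply: eq_bigr => j _; rewrite mulr_suml.
by apply: eq_bigr => l _; rewrite mulrA.
Qed.

(** Subtracting the hypothesis from the implicit equation for [S] shows that the difference of the
    two sides dominates its own image under [L]. *)
Lemma sequential_mx_le (x y : 'I_n -> R) :
  (forall i, x i <= \sum_j L i j * x j + \sum_j U i j * y j) ->
  forall i, x i <= \sum_j S i j * y j.
Proof.
move=> xy i; rewrite -subr_ge0.
apply: (@strictly_lower_ge0 (fun i => \sum_j S i j * y j - x i)) => {}i.
under eq_bigr do rewrite mulrBr.
rewrite sumrB lerBrDr addrAC lerBlDr [in leRHS]sequential_mx_mul -addrA.
by rewrite lerD2l addrC.
Qed.

Hypothesis e_irr : irreflexive e.

Lemma influence_mx_diag i : M i i = 0.
Proof. by rewrite mxE e_irr. Qed.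

Lemma spectral_radius_influence : spectral_radius M < 1.
Proof.
have [q [q0 q1 Mq]] := influence_mx_row_sum; apply: le_lt_trans q1.
exact: spectral_radius_row_sum influence_mx_ge0 _.
Qed.

Lemma spectral_radius_sequential : spectral_radius S < 1.
Proof.
have [q [q0 q1 Mq]] := influence_mx_row_sum; apply: le_lt_trans (q1).
apply: spectral_radius_row_sum sequential_mx_ge0 _ => // i; rewrite -subr_ge0.
(* The row sums of [S] obey the same bound [q] as those of [M]. Comparison reduces this to [q] times
   the row sum of [L] plus that of [U] being at most [q], and since [q < 1] the row sum of [M]
   dominates the left side. *)
apply: (@strictly_lower_ge0 (fun i => q - \sum_j S i j)) => {}i.
have -> : \sum_j S i j = \sum_l L i l * (\sum_j S l j) + \sum_j U i j.
  have sum1 (F : 'I_n -> R) : \sum_j F j * 1 = \sum_j F j.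
    by apply: eq_bigr => j _; rewrite mulr1.
  have /= := sequential_mx_mul (fun=> 1) i; rewrite !sum1 => ->.
  by congr (_ + _); apply: eq_bigr => j _; rewrite sum1.
under eq_bigr do rewrite mulrBr.
rewrite sumrB opprD addrA addrAC lerD2r lerBrDr.
apply: le_trans (Mq i).
have := influence_split (fun=> 1) (influence_mx_diag i).
under eq_bigr do rewrite mulr1; move=> ->.
rewrite lerD//; apply: ler_sum => j _; last by rewrite mulr1.
by rewrite ler_wpM2l ?influence_lower_ge0// ltW.
Qed.

Lemma random_scan_mxE i j :
  random_scan_mx tau e J i j = n%:R^-1 * M i j + (n%:R - 1) / n%:R * (i ==
    j)%:R.
Proof. by rewrite [LHS]mxE [X in X + _]mxE [X in _ + X]mxE mulr_natr. Qed.

Lemma random_scan_mx_ge0 i j : 0 <= random_scan_mx tau e J i j.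
Proof.
rewrite random_scan_mxE addr_ge0// mulr_ge0 ?invr_ge0 ?influence_mx_ge0//.
by rewrite divr_ge0// subr_ge0 ler1n (leq_ltn_trans _ (ltn_ord i)).
Qed.

Lemma spectral_radius_random_scan : spectral_radius (random_scan_mx tau e J) <
  1.
Proof.
have [q [q0 q1 Mq]] := influence_mx_row_sum.
have [n0|n0] := posnP n.
  apply: (@le_lt_trans _ _ 0) => //.
  apply: spectral_radius_row_sum random_scan_mx_ge0 _ => // i.
  by have := ltn_ord i; rewrite [X in (_ < X)%N]n0.
have n_gt0 : (0 : R) < n%:R by rewrite ltr0n.
(* This bound is the average of [q] and 1 with weights [1/n] and [(n-1)/n]. *)
apply: (@le_lt_trans _ _ (n%:R^-1 * q + (n%:R - 1) / n%:R)).
  apply: spectral_radius_row_sum random_scan_mx_ge0 _ => [|i].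
    by rewrite addr_ge0 ?mulr_ge0 ?invr_ge0 ?divr_ge0// subr_ge0 ler1n.
  under eq_bigr do rewrite random_scan_mxE.
  rewrite big_split/= -!mulr_sumr lerD ?ler_wpM2l ?invr_ge0//.
  rewrite (bigD1 i)//= eqxx big1 ?addr0 ?mulr1// => j /negbTE.
  by rewrite eq_sym => ->.
rewrite [ltRHS](_ : 1 = n%:R^-1 * 1 + (n%:R - 1) / n%:R); last first.
  by field; rewrite gt_eqF.
by rewrite ltrD2r ltr_pM2l ?invr_gt0.
Qed.

End InfluenceMatrix.

(** * Lebesgue measure on R^d *)

Section PowerMeasureTheory.
Local Open Scope ereal_scope.
Context {dT : measure_display} {T : measurableType dT} {R : realType}.
Variable l : {sigma_finite_measure set T -> \bar R}.

Lemma integral_power_measureS d (f : d.+1.-tuple T -> \bar R) :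
  measurable_fun setT f -> (forall x, 0 <= f x) ->
  \int[power_measure l d.+1]_x f x =
  \int[l]_x \int[power_measure l d]_y f (cons_pair (x, y)).
Proof.
move=> mf f0.
rewrite [LHS](@ge0_integral_pushforward _ _ _ _ _ (@cons_pair _ T d) _ (l \x
  power_measure l d) setT)//.
rewrite preimage_setT fubini_tonelli1//=.
exact: measurableT_comp.
Qed.

Lemma power_measure_prod d (g : T -> R) :
  measurable_fun setT g -> (forall x, (0 <= g x)%R) ->
  \int[power_measure l d]_x (\prod_(c < d) g (tnth x c))%:E =
  \prod_(c < d) \int[l]_x (g x)%:E.
Proof.
move=> mg g0; elim: d => [|d IHd].
  under eq_integral do rewrite big_ord0.
  by rewrite big_ord0 integral_cst// mul1e; exact: diracT.
have mprod k : measurable_fun setT (fun x : k.-tuple T => (\prod_(c < k) g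
  (tnth x c))%:E).
  apply/measurable_EFinP/measurable_prod => c _.
  by apply: measurableT_comp => //; exact: measurable_tnth.
have prod0 k (x : k.-tuple T) : 0 <= (\prod_(c < k) g (tnth x c))%:E.
  by rewrite lee_fin prodr_ge0.
rewrite integral_power_measureS//.
transitivity (\int[l]_x ((g x)%:E * \prod_(c < d) \int[l]_x (g x)%:E)).
  apply: eq_integral => x _; rewrite -IHd -ge0_integralZl ?lee_fin//.
  apply: eq_integral => y _; rewrite big_ord_recl tnth0 EFinM.
  by congr (_ * _%:E); apply: eq_bigr => c _; rewrite tnthS.
  exact: mprod.
rewrite ge0_integralZr// ?big_ord_recl//.
- exact/measurable_EFinP.
- by move=> x _; rewrite lee_fin.
- by apply: prode_ge0 => c _; apply: integral_ge0 => x _; rewrite lee_fin.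
Qed.

(** Tonelli peels off one coordinate at a time. The map may vary with the coordinate because the
    components of a translation vector do. *)
Lemma power_measure_map d (phi : 'I_d -> T -> T) (f : d.-tuple T -> \bar R) :
  (forall c, measurable_fun setT (phi c)) ->
  (forall c A, measurable A -> l (phi c @^-1` A) = l A) ->
  measurable_fun setT f -> (forall x, 0 <= f x) ->
  \int[power_measure l d]_x f [tuple phi c (tnth x c) | c < d] =
  \int[power_measure l d]_x f x.
Proof.
move=> mphi lphi; elim: d phi mphi lphi f => [|d IHd] phi mphi lphi f mf f0.
  by apply: eq_integral => x _; congr f; apply: eq_from_tnth => -[].
have mmap k (psi : 'I_k -> T -> T) : (forall c, measurable_fun setT (psi c)) ->
    measurable_fun setT (fun x : k.-tuple T => [tuple psi c (tnth x c) | c <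
      k]).
  move=> mpsi; apply/measurable_fun_tnthP => c /=.
  rewrite (_ : _ \o _ = fun x => psi c (tnth x c)); last first.
    by apply/funext => x /=; rewrite tnth_mktuple.
  by apply: measurableT_comp => //; exact: measurable_tnth.
rewrite !integral_power_measureS//; last exact: measurableT_comp (mmap _ _
  mphi).
pose F x := \int[power_measure l d]_y f (cons_pair (x, y)).
have mfc x : measurable_fun setT (fun y => f (cons_pair (x, y))).
  by do 2 apply: measurableT_comp => //.
have mF : measurable_fun setT F.
  apply: (measurable_fun_fubini_tonelli_F (m2 := power_measure l d)
    (f \o @cons_pair _ T d)) => [|x]; last exact: f0.
  exact: measurableT_comp.
have F0 x : 0 <= F x by exact: integral_ge0.
transitivity (\int[l]_x F (phi ord0 x)).
  apply: eq_integral => x _; rewrite /F.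
  rewrite -[RHS](IHd (fun c => phi (lift ord0 c)))//.
  apply: eq_integral => y _; congr f; apply: eq_from_tnth => c.
  rewrite tnth_mktuple; have [j ->|->] := unliftP ord0 c.
    by rewrite !tnthS tnth_mktuple.
  by rewrite !tnth0.
  by move=> c A mA; exact: lphi.
rewrite -[LHS](@ge0_integral_pushforward _ _ _ _ _ (phi ord0) _ l setT F)//.
by apply: eq_measure_integral => A mA _; exact: lphi.
Qed.

End PowerMeasureTheory.

Section Translation.
Context {R : realType}.

(** Named so that it carries a measurable-function structure, which makes its pushforward of
    Lebesgue measure a measure. *)
Definition translate (t : R) (x : measurableTypeR R) : measurableTypeR R :=
  x + t.

Let measurable_translate t : measurable_fun setT (translate t).
Proof. exact: measurable_funD. Qed.

HB.instance Definition _ t := isMeasurableFun.Build _ _ _ _ (translate t)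
  (measurable_translate t).

End Translation.

Section EuclidTheory.
Local Open Scope ereal_scope.
Context {R : realType} {d : nat}.
Local Notation leb := (lebesgue_euclid R d).
Local Notation E := (euclid R d).

Definition affine_map (s : R) (t : E) (x : E) : E :=
  [tuple (s * tnth x c + tnth t c)%R | c < d].

Lemma measurable_affine_map s t : measurable_fun setT (affine_map s t).
Proof.
apply/measurable_fun_tnthP => c.
rewrite (_ : _ \o _ = fun x => (s * tnth x c + tnth t c)%R); last first.
  by apply/funext => x; rewrite /= tnth_mktuple.
apply: measurable_funD => //; apply: measurable_funM => //.
exact: measurable_tnth.
Qed.

(** The condition on [s] leaves two cases: translations, checked on intervals, and their composites
    with the reflection. The former relate Gaussians with different means; the latter show that a
    centred one has mean zero. *)
Lemma lebesgue_measure_affine (s t : R) (A : set R) : `|s|%R = 1%R ->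
  measurable A ->
  (@lebesgue_measure R) ((fun x => s * x + t)%R @^-1` A) = lebesgue_measure A.
Proof.
move=> s1 mA.
have shift B : measurable B ->
    pushforward (@lebesgue_measure R) (translate t) B =
    lebesgue_measure B.
  move=> mB; apply/esym/lebesgue_measure_unique => //= _ [[a b]] _ <-.
  rewrite /pushforward /translate [X in _ = lebesgue_measure X](_ : _ = `](a -
    t)%R, (b - t)%R]%classic).
    rewrite !lebesgue_measure_itv/= !lte_fin ltrD2r.
    by case: ifP => // _; rewrite -!EFinD; congr (_%:E); ring.
  by apply/seteqP; split => x /=; rewrite !in_itv/= ltrBlDr lerBrDr.
have mshift : measurable ((translate t) @^-1` A).
  by rewrite -[X in measurable X]setTI; apply: measurable_funD.
have [s0|s0] := leP 0%R s.
  have -> : s = 1%R by rewrite -s1 ger0_norm.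
  under [X in X @^-1` _]eq_fun do rewrite mul1r.
  exact: shift.
have -> : s = (-1)%R by rewrite -s1 ltr0_norm// opprK.
under [X in X @^-1` _]eq_fun do rewrite mulN1r.
rewrite -[RHS]shift// -[RHS]lebesgue_measureN//.
Qed.

Lemma integral_lebesgue_affine (s : R) (t : E) (f : E ->
  \bar R) : `|s|%R = 1%R ->
  measurable_fun setT f -> (forall x, 0 <= f x) ->
  \int[leb]_x f (affine_map s t x) = \int[leb]_x f x.
Proof.
move=> s1 mf f0.
rewrite -(@power_measure_map _ _ _ (@lebesgue_measure R) d
  (fun c (x : measurableTypeR R) => s * x + tnth t c : measurableTypeR R)%R
    f)//.
- move=> c; apply: measurable_funD => //; exact: measurable_funM.
- by move=> c A mA; exact: lebesgue_measure_affine.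
Qed.

End EuclidTheory.

(** * Measures given by a density *)

Section Density.
Local Open Scope ereal_scope.
Context {dT : measure_display} {T : measurableType dT} {R : realType}.

Import HBNNSimple.

(** On indicators this is the formula for [mu]. Linearity extends it to simple functions, and
    monotone convergence on both sides gives the general case. *)
Lemma ge0_integral_density (m mu : {measure set T -> \bar R}) (w : T ->
  R) (f : T -> \bar R) :
  measurable_fun setT w -> (forall x, (0 <= w x)%R) ->
  (forall A, measurable A -> mu A = \int[m]_(x in A) (w x)%:E) ->
  measurable_fun setT f -> (forall x, 0 <= f x) ->
  \int[mu]_x f x = \int[m]_x (f x * (w x)%:E).
Proof.
move=> mw w0 muE mf f0.
have mwE : measurable_fun setT (EFin \o w) by exact/measurable_EFinP.
pose f_ := nnsfun_approx measurableT mf.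
have sfun n : \int[mu]_x (f_ n x)%:E = \int[m]_x ((f_ n x)%:E * (w x)%:E).
  under eq_integral do rewrite fimfunE -fsumEFin//.
  rewrite ge0_integral_fsum//=; last 2 first.
  - by move=> r; apply/measurable_EFinP/measurable_funM.
  - by move=> r x _; rewrite nnfun_muleindic_ge0.
  under [in RHS]eq_integral => x _.
    rewrite fimfunE -fsumEFin// ge0_mule_fsuml; last first.
      by move=> r; rewrite nnfun_muleindic_ge0.
    over.
  rewrite ge0_integral_fsum//=; last 2 first.
  - move=> r; apply: emeasurable_funM => //.
    by apply/measurable_EFinP/measurable_funM.
  - by move=> r x _; rewrite mule_ge0 ?lee_fin//; exact: nnfun_muleindic_ge0.
  apply: eq_fsbigr => r /[!inE] -[x _ xr].
  have r0 : (0 <= r)%R by rewrite -xr.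
  have mr : measurable (f_ n @^-1` [set r]) by [].
  under eq_integral do rewrite EFinM.
  under [in RHS]eq_integral do rewrite EFinM -muleA.
  rewrite !ge0_integralZl//.
  congr (_ * _); rewrite integral_indic// setIT muE// [LHS]integral_mkcond.
  apply: eq_integral => y _; rewrite /patch indicE.
  by case: ifP => _; rewrite ?mul1e ?mul0e.
  - by apply: emeasurable_funM => //; exact/measurable_EFinP.
  - by move=> y _; rewrite mule_ge0// lee_fin.
  - exact/measurable_EFinP.
transitivity (limn (fun n => \int[mu]_x (f_ n x)%:E)).
  rewrite -monotone_convergence//.
  - by apply: eq_integral => x _; apply/esym/cvg_lim => //;
      exact: cvg_nnsfun_approx.
  - by move=> n; exact/measurable_EFinP.
  - by move=> n x _; rewrite lee_fin.
  - by move=> x _ i j ij; rewrite lee_fin; exact/lefP/nd_nnsfun_approx.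
under [X in limn X]eq_fun do rewrite sfun.
rewrite -monotone_convergence//.
- apply: eq_integral => x _; apply/cvg_lim => //.
  apply: cvgeZr => //.
  exact: cvg_nnsfun_approx.
- by move=> n; apply: emeasurable_funM => //; exact/measurable_EFinP.
- by move=> n x _; rewrite mule_ge0// lee_fin.
- move=> x _ i j ij; rewrite lee_pmul// ?lee_fin//.
  exact/lefP/nd_nnsfun_approx.
Qed.

Lemma density_probability (m : {measure set T -> \bar R}) (w : T -> R) :
  measurable_fun setT w -> (forall x, (0 <= w x)%R) -> \int[m]_x (w x)%:E = 1 ->
  exists mu : probability T R,
    forall A, measurable A -> mu A = \int[m]_(x in A) (w x)%:E.
Proof.
move=> mw w0 w1; pose p A := \int[m]_(x in A) (w x)%:E.
have p0 : p set0 = 0 by rewrite /p integral_set0.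
have p_ge0 A : 0 <= p A by apply: integral_ge0 => x _; rewrite lee_fin.
have p_sigma : semi_sigma_additive p.
  move=> /= A mA tA mUA; rewrite /p ge0_integral_bigcup//=; last 2 first.
  - by apply/measurable_EFinP; exact: measurable_funTS.
  - by move=> x _; rewrite lee_fin.
  apply: is_cvg_ereal_nneg_natsum_cond => k _ _.
  by apply: integral_ge0 => /= x ?; rewrite lee_fin.
pose pm := isMeasure.Build _ _ _ p p0 p_ge0 p_sigma.
pose pM : {measure set T -> \bar R} := HB.pack p pm.
pose pp := Measure_isProbability.Build _ _ R pM w1.
by exists (HB.pack_for (probability T R) p pm pp).
Qed.

End Density.

(** * Gaussian laws *)

Section EuclideanVectors.
Context {R : realType} {d : nat}.
Local Notation E := (euclid R d).
Implicit Types x y z : E.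

Definition dot x y : R := \sum_(c < d) tnth x c * tnth y c.
Definition vsub x y : E := [tuple tnth x c - tnth y c | c < d].

Lemma sqnorm_ge0 x : 0 <= sqnorm x.
Proof. by apply: sumr_ge0 => c _; exact: sqr_ge0. Qed.

Lemma enorm_ge0 x : 0 <= enorm x.
Proof. exact: sqrtr_ge0. Qed.

Lemma sqr_enorm x : enorm x ^+ 2 = sqnorm x.
Proof. by rewrite sqr_sqrtr ?sqnorm_ge0. Qed.

Lemma dotxx x : dot x x = enorm x ^+ 2.
Proof. by rewrite sqr_enorm; apply: eq_bigr => c _; rewrite expr2. Qed.

Lemma dotC x y : dot x y = dot y x.
Proof. by apply: eq_bigr => c _; rewrite mulrC. Qed.

Lemma sqdistE x y : sqdist x y = sqnorm (vsub x y).
Proof. by apply: eq_bigr => c _; rewrite tnth_mktuple. Qed.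

Lemma edistE x y : edist x y = enorm (vsub x y).
Proof. by rewrite /edist sqdistE. Qed.

Lemma sqdist_expand x y : sqdist x y = sqnorm x - 2 * dot x y + sqnorm y.
Proof.
rewrite mulr_sumr -sumrB -big_split/=; apply: eq_bigr => c _.
ring.
Qed.

Lemma sqr_tnth_le x c : tnth x c ^+ 2 <= sqnorm x.
Proof. by rewrite /sqnorm (bigD1 c)//= lerDl sumr_ge0// => j _;
  exact: sqr_ge0. Qed.

Lemma dot_le_enorm x y : dot x y <= enorm x * enorm y.
Proof.
have null z t : enorm z = 0 -> dot z t = 0.
  move=> z0; apply: big1 => c _.
  suff -> : tnth z c = 0 by rewrite mul0r.
  apply/eqP; rewrite -sqrf_eq0 eq_le sqr_ge0 andbT.
  by apply: le_trans (sqr_tnth_le z c) _; rewrite -sqr_enorm z0 expr0n.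
have [x0|x0] := eqVneq (enorm x) 0; first by rewrite null// x0 mul0r.
have [y0|y0] := eqVneq (enorm y) 0; first by rewrite dotC null// y0 mulr0.
have xy0 : 0 < enorm x * enorm y.
  by rewrite mulr_gt0// lt_def ?x0 ?y0 enorm_ge0.
(* Cauchy-Schwarz: this sum of squares equals [2 * (enorm x * enorm y)] times the desired gap, and
   the factor is positive once neither norm vanishes. *)
have : 0 <= \sum_(c < d) (enorm y * tnth x c - enorm x * tnth y c) ^+ 2.
  by apply: sumr_ge0 => c _; exact: sqr_ge0.
have -> : \sum_(c < d) (enorm y * tnth x c - enorm x * tnth y c) ^+ 2 =
    enorm y ^+ 2 * sqnorm x - 2 * (enorm x * enorm y) * dot x y
    + enorm x ^+ 2 * sqnorm y.
  by rewrite !mulr_sumr -sumrB -big_split/=; apply: eq_bigr => c _; ring.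
rewrite -!sqr_enorm.
have -> : enorm y ^+ 2 * enorm x ^+ 2 - 2 * (enorm x * enorm y) * dot x y +
    enorm x ^+ 2 * enorm y ^+ 2 =
    2 * (enorm x * enorm y) * (enorm x * enorm y - dot x y) by ring.
by rewrite pmulr_rge0 ?subr_ge0// mulr_gt0.
Qed.

(** Testing with [v = x] suffices. Bounds on the norm of a mean thereby reduce to integrals of
    scalar linear functions. *)
Lemma enorm_le_dual x (B : R) : 0 <= B ->
  (forall v, dot v x <= enorm v * B) -> enorm x <= B.
Proof.
move=> B0 /(_ x); rewrite dotxx expr2.
have [->|x0] := eqVneq (enorm x) 0; first by [].
by rewrite ler_pM2l// lt_def x0 enorm_ge0.
Qed.

Lemma edist_le x y : edist x y <= enorm x + enorm y.
Proof.
rewrite edistE; apply: enorm_le_dual => [|v];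
  first by rewrite addr_ge0 ?enorm_ge0.
have -> : dot v (vsub x y) = dot v x - dot v y.
  by rewrite -sumrB; apply: eq_bigr => c _; rewrite tnth_mktuple mulrBr.
rewrite mulrDr lerD ?dot_le_enorm//.
have -> : - dot v y = dot [tuple - tnth v c | c < d] y.
  by rewrite -sumrN; apply: eq_bigr => c _; rewrite tnth_mktuple mulNr.
apply: le_trans (dot_le_enorm _ _) _; rewrite ler_wpM2r ?enorm_ge0//.
rewrite le_eqVlt; apply/orP; left; apply/eqP; congr Num.sqrt.
by apply: eq_bigr => c _; rewrite tnth_mktuple sqrrN.
Qed.

Lemma sqnorm_le_sqdist x y : sqnorm y <= 2 * sqdist x y + 2 * sqnorm x.
Proof.
rewrite !mulr_sumr -big_split/=; apply: ler_sum => c _.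
rewrite -subr_ge0.
have -> : 2 * (tnth x c - tnth y c) ^+ 2 + 2 * tnth x c ^+ 2 - tnth y c ^+ 2
  = (2 * tnth x c - tnth y c) ^+ 2 by ring.
exact: sqr_ge0.
Qed.

Lemma enorm_le_sqnorm x : enorm x <= 1 + sqnorm x.
Proof.
rewrite -sqr_enorm -subr_ge0.
have -> : 1 + enorm x ^+ 2 - enorm x = (enorm x - 2^-1) ^+ 2 + 3 / 4 by field.
by rewrite addr_ge0 ?sqr_ge0// divr_ge0.
Qed.

Lemma tnth_le_enorm x c : `|tnth x c| <= enorm x.
Proof.
rewrite -(ler_pXn2r (n := 2))// ?nnegrE ?enorm_ge0//.
by rewrite real_normK ?num_real// sqr_enorm sqr_tnth_le.
Qed.

Lemma measurable_sqnorm : measurable_fun setT (@sqnorm R d).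
Proof.
apply: measurable_sum => c; apply: measurable_funX.
exact: measurable_tnth.
Qed.

Lemma measurable_sqrt : measurable_fun setT (@Num.sqrt R).
Proof. by apply: continuous_measurable_fun; exact: sqrt_continuous. Qed.

Lemma measurable_enorm : measurable_fun setT (@enorm R d).
Proof. exact: measurableT_comp measurable_sqrt measurable_sqnorm. Qed.

Lemma measurable_edist :
  measurable_fun setT (fun z : E * E => edist z.1 z.2).
Proof.
apply: measurableT_comp measurable_sqrt _.
apply: measurable_sum => c; apply: measurable_funX; apply: measurable_funB.
  by apply: (measurableT_comp (measurable_tnth c)).
by apply: (measurableT_comp (measurable_tnth c)).
Qed.

Lemma measurable_sqdist x : measurable_fun setT (sqdist x).
Proof.
apply: measurable_sum => c; apply: measurable_funX;
  apply: measurable_funB => //.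
exact: measurable_tnth.
Qed.

End EuclideanVectors.

Section Gaussian.
Local Open Scope ereal_scope.
Context {R : realType} {d : nat}.
Local Notation leb := (lebesgue_euclid R d).
Local Notation E := (euclid R d).
Implicit Types mu nu : probability E R.

Definition gaussian (a : R) (x : E) : R := expR (- (a / 2 * sqnorm x)).

Lemma gaussian_gt0 a x : (0 < gaussian a x)%R.
Proof. exact: expR_gt0. Qed.

Lemma measurable_gaussian a : measurable_fun setT (gaussian a).
Proof.
apply: measurableT_comp => //; apply: measurableT_comp => //.
by apply: measurable_funM => //; exact: measurable_sqnorm.
Qed.

Lemma integral_gaussian1 (a : R) : (0 < a)%R -> exists2 z : R, (0 < z)%R &
  \int[@lebesgue_measure R]_x (expR (- (a / 2 * x ^+ 2)))%:E = z%:E.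
Proof.
(* [s] is the standard deviation that corresponds to the precision [a]. *)
move=> a0; pose s : R := ((Num.sqrt a)^-1)%R.
have s0 : s != 0%R by rewrite invr_neq0// gt_eqF// sqrtr_gt0.
exists ((normal_peak s)^-1)%R; first by rewrite invr_gt0 normal_peak_gt0.
rewrite -[RHS]mule1 -(integral_normal_pdf 0 s) -ge0_integralZl//=; last 3 first.
- by apply/measurable_EFinP; exact: measurable_normal_pdf.
- by move=> x _; rewrite lee_fin normal_pdf_ge0.
- by rewrite lee_fin invr_ge0 normal_peak_ge0.
apply: eq_integral => x _; rewrite -EFinM normal_pdfE//=.
rewrite mulKf ?gt_eqF ?normal_peak_gt0// /normal_fun subr0 /s exprVn.
rewrite sqr_sqrtr ?(ltW a0)//; congr (expR _)%:E.
by field; rewrite gt_eqF.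
Qed.

Lemma integral_gaussian (a : R) : (0 < a)%R ->
  exists2 z : R, (0 < z)%R & \int[leb]_x (gaussian a x)%:E = z%:E.
Proof.
move=> /integral_gaussian1[z z0 az]; exists (z ^+ d)%R; first exact: exprn_gt0.
transitivity (\int[leb]_x (\prod_(c < d) expR (- (a / 2 * tnth x c ^+ 2)))%:E).
  by apply: eq_integral => x _; rewrite -expR_sum /gaussian mulr_sumr sumrN.
rewrite (power_measure_prod (@lebesgue_measure R) d
  (g := fun x : measurableTypeR R => expR (- (a / 2 * x ^+ 2)))).
- under eq_bigr do rewrite az.
  elim: (d) => [|k IHk]; first by rewrite big_ord0 expr0.
  by rewrite big_ord_recl IHk exprS EFinM.
- apply: measurableT_comp => //; apply: measurableT_comp => //.
  by apply: measurable_funM => //; exact: measurable_funX.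
- by move=> x; exact: expR_ge0.
Qed.

(** The isotropic normal law with mean [m] and covariance [1/a] times the identity; its normalising
    constant stays existential. *)
Definition is_gaussian (a : R) (m : E) mu : Prop :=
  has_density_propto mu (fun x => (gaussian a (vsub x m))%:E).

Lemma measurable_gaussian_shift a m :
  measurable_fun setT (fun x => gaussian a (vsub x m)).
Proof.
rewrite (_ : (fun x => _) = gaussian a \o affine_map 1 [tuple - tnth m c | c <
  d])%R.
  exact: measurableT_comp (measurable_gaussian a) (measurable_affine_map _ _).
apply/funext => x /=; congr gaussian; apply: eq_from_tnth => c.
by rewrite !tnth_mktuple mul1r.
Qed.

Let zero : E := [tuple 0%R | c < d].

Lemma vsub0 x : vsub x zero = x.
Proof. by apply: eq_from_tnth => c; rewrite !tnth_mktuple subr0. Qed.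

Lemma is_gaussian_exists (a : R) : (0 < a)%R ->
  exists mu, is_gaussian a zero mu.
Proof.
move=> /integral_gaussian[z z0 az].
have [|x|//|mu muE] := @density_probability _ _ _ leb (fun x => z^-1 * gaussian
  a x)%R.
- by apply: measurable_funM => //; exact: measurable_gaussian.
- by rewrite mulr_ge0 ?invr_ge0 ?(ltW z0) ?(ltW (gaussian_gt0 _ _)).
- under eq_integral do rewrite EFinM.
  rewrite ge0_integralZl//=; last 3 first.
  + by apply/measurable_EFinP; exact: measurable_gaussian.
  + by move=> y _; rewrite lee_fin ltW// gaussian_gt0.
  + by rewrite lee_fin invr_ge0 ltW.
  by rewrite az -EFinM mulVf// gt_eqF.
exists mu; exists (z^-1)%R; first by rewrite invr_gt0.
move=> A mA.
rewrite (muE A mA).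
apply: eq_integral => x _.
by rewrite vsub0.
Qed.

(** Changing variables by [affine_map s m] turns the density around [m] into the centred one, as
    multiplication by [s] preserves the norm. The two normalising constants agree because both are
    the inverse of the integral [z]. *)
Lemma is_gaussian_affine a s m mu nu : (0 < a)%R -> `|s|%R = 1%R ->
  is_gaussian a zero mu -> is_gaussian a m nu ->
  forall A, measurable A -> nu A = mu (affine_map s m @^-1` A).
Proof.
move=> a0 s1 [c c0 muE] [c' c'0 nuE] A mA.
have [z z0 az] := integral_gaussian a0.
have mpre B : measurable B -> measurable (affine_map s m @^-1` B).
  by move=> mB; rewrite -[X in measurable X]setTI; exact: measurable_affine_map.
have restrict (B : set E) (f : E -> R) : \int[leb]_(x in B) (f x)%:E =
    \int[leb]_x (\1_B x * f x)%:E.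
  rewrite integral_mkcond; apply: eq_integral => x _.
  by rewrite /patch indicE; case: ifP => _; rewrite ?mul1r ?mul0r.
have scale (k : R) (B : set E) (f : E -> R) : (0 < k)%R -> measurable B ->
    measurable_fun setT f -> (forall x, 0 <= f x)%R ->
    \int[leb]_(x in B) (k%:E * (f x)%:E) = k%:E * \int[leb]_(x in B) (f x)%:E.
  move=> k0 mB mf f0; rewrite ge0_integralZl//.
  - by apply/measurable_EFinP; exact: measurable_funTS.
  - by move=> x _; rewrite lee_fin.
  - by rewrite lee_fin ltW.
have g0 m' x : (0 <= gaussian a (vsub x m'))%R by exact/ltW/gaussian_gt0.
have shift B : measurable B -> \int[leb]_(x in B) (gaussian a (vsub x m))%:E =
    \int[leb]_(x in affine_map s m @^-1` B) (gaussian a (vsub x zero))%:E.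
  move=> mB; rewrite restrict [RHS]restrict.
  rewrite -[LHS](@integral_lebesgue_affine _ _ s m
    (fun x => (\1_B x * gaussian a (vsub x m))%:E)); last 3 first.
  - exact: s1.
  - apply/measurable_EFinP; apply: measurable_funM => //.
    exact: measurable_gaussian_shift.
  - by move=> x; rewrite lee_fin mulr_ge0.
  apply: eq_integral => x _; congr (_ * expR (- (_ * _)))%:E; rewrite !vsub0.
  apply: eq_bigr => k _; rewrite !tnth_mktuple addrK exprMn.
  by rewrite -(real_normK (num_real s)) s1 expr1n mul1r.
have muT : c%:E * z%:E = 1.
  have := muE _ measurableT; rewrite probability_setT.
  rewrite (scale _ _ _ c0 measurableT (measurable_gaussian_shift _ _) (g0 _)).
  by move=> ->; rewrite -az; congr (_ * _); apply: eq_integral => x _;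
    rewrite vsub0.
have nuT : c'%:E * z%:E = 1.
  have := nuE _ measurableT; rewrite probability_setT.
  rewrite (scale _ _ _ c'0 measurableT (measurable_gaussian_shift _ _) (g0 _)).
  move=> ->; rewrite (shift _ measurableT) preimage_setT -az; congr (_ * _).
  by apply: eq_integral => x _; rewrite vsub0.
have cc' : c = c'.
  move: muT; rewrite -nuT -!EFinM => -[]; exact/mulIf/lt0r_neq0.
rewrite (nuE _ mA) (muE _ (mpre _ mA)).
have mg m' := measurable_gaussian_shift a m'.
rewrite (scale _ _ _ c'0 mA (mg _) (g0 _)) (scale _ _ _ c0 (mpre _ mA) (mg _)
  (g0 _)).
by rewrite (shift _ mA) cc'.
Qed.

Lemma gaussian_second_moment (a : R) mu : (0 < a)%R -> is_gaussian a zero mu ->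
  \int[mu]_x (sqnorm x)%:E < +oo.
Proof.
move=> a0 [c c0 muE].
rewrite (@ge0_integral_density _ _ _ leb mu (fun x => c * gaussian a x)%R)//.
- have a20 : (0 < a / 2)%R by rewrite divr_gt0.
  have [z z0 az] := integral_gaussian a20.
  (* Half of the exponent absorbs the square: with [t = a |x|^2 / 4] one has [|x|^2 = (4 / a) t] and
     [t exp (- t) <= 1], which leaves a Gaussian of precision [a / 2]. *)
  apply: (@le_lt_trans _ _ (\int[leb]_x ((c * (4 / a))%:E * (gaussian (a / 2)
    x)%:E))).
    apply: ge0_le_integral => //.
    + move=> x _; rewrite mule_ge0// lee_fin ?sqnorm_ge0// mulr_ge0 ?(ltW c0)//.
      exact/ltW/gaussian_gt0.
    + apply/measurable_EFinP/measurable_funM; first exact: measurable_sqnorm.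
      by apply: measurable_funM => //; exact: measurable_gaussian.
    + by apply/measurable_EFinP/measurable_funM => //;
        exact: measurable_gaussian.
    + move=> x _; rewrite -!EFinM lee_fin mulrCA -mulrA ler_pM2l//.
      pose t : R := (sqnorm x * (a / 4))%R.
      have t1 : (t * expR (- t) <= 1)%R.
        rewrite -[leRHS](expRxMexpNx_1 t) ler_wpM2r ?expR_ge0//.
        by apply: le_trans (expR_ge1Dx _); rewrite lerDr.
      have -> : gaussian a x = (gaussian (a / 2) x * expR (- t))%R.
        by rewrite /gaussian -expRD; congr expR; rewrite /t; field.
      have g0 : (0 < gaussian (a / 2) x)%R by exact: gaussian_gt0.
      have -> : (sqnorm x * (gaussian (a / 2) x * expR (- t)) =
          4 / a * (t * expR (- t)) * gaussian (a / 2) x)%R.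
        by rewrite /t; field; rewrite gt_eqF.
      by rewrite ler_wpM2r ?(ltW g0)// ger_pMr// divr_gt0.
  rewrite ge0_integralZl//; last 3 first.
  - by apply/measurable_EFinP; exact: measurable_gaussian.
  - by move=> x _; rewrite lee_fin ltW// gaussian_gt0.
  - by rewrite lee_fin mulr_ge0 ?(ltW c0)// divr_ge0 ?(ltW a0).
  by rewrite az -EFinM ltry.
- by apply: measurable_funM => //; exact: measurable_gaussian.
- by move=> x; rewrite mulr_ge0 ?(ltW c0)// ltW// gaussian_gt0.
- move=> A mA; apply: (eq_trans (muE A mA)).
  by apply: eq_integral => x _; rewrite vsub0.
- by apply/measurable_EFinP; exact: measurable_sqnorm.
- by move=> x; rewrite lee_fin sqnorm_ge0.
Qed.

End Gaussian.

(** * Moments and Wasserstein distance *)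

Section Moments.
Local Open Scope ereal_scope.
Context {R : realType} {d : nat}.
Local Notation E := (euclid R d).
Implicit Types mu nu : probability E R.

Definition finite_second_moment nu : Prop := \int[nu]_x (sqnorm x)%:E < +oo.

Definition mean nu : E := [tuple (\int[nu]_x tnth x c)%R | c < d].

Lemma measure_eq_mean mu nu : mu ≡μ nu -> mean mu = mean nu.
Proof.
move=> mn; apply: eq_from_tnth => c; rewrite !tnth_mktuple /Rintegral.
by congr fine; apply: eq_measure_integral => A mA _; exact: mn.
Qed.

Lemma integrable_sqnorm nu : finite_second_moment nu ->
  nu.-integrable setT (fun x => (sqnorm x)%:E).
Proof.
move=> nu2; apply/integrableP; split; first by apply/measurable_EFinP;
  exact: measurable_sqnorm.
by under eq_integral do rewrite /= ger0_norm ?sqnorm_ge0//.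
Qed.

Lemma integrable_cst_prob nu (k : R) : nu.-integrable setT (fun=> k%:E).
Proof. exact: finite_measure_integrable_cst. Qed.

Lemma integrable_enorm nu : finite_second_moment nu ->
  nu.-integrable setT (fun x => (enorm x)%:E).
Proof.
move=> nu2; apply: (@le_integrable _ _ _ nu setT _ _ (fun x => (cst 1 \+ (fun x
  => (sqnorm x)%:E)) x)) => //.
- by apply/measurable_EFinP; exact: measurable_enorm.
- move=> x _ /=; rewrite lee_fin !ger0_norm ?addr_ge0 ?sqnorm_ge0 ?enorm_ge0//.
  exact: enorm_le_sqnorm.
- apply: integrableD => //; first exact: integrable_cst_prob.
  exact: integrable_sqnorm.
Qed.

Lemma integrable_tnth nu c : finite_second_moment nu ->
  nu.-integrable setT (fun x => (tnth x c)%:E).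
Proof.
move=> nu2; apply: le_integrable (integrable_enorm nu2) => //.
- by apply/measurable_EFinP; exact: measurable_tnth.
- by move=> x _ /=; rewrite lee_fin [leRHS]ger0_norm ?enorm_ge0//;
    exact: tnth_le_enorm.
Qed.

Lemma integrable_dot nu v : finite_second_moment nu ->
  nu.-integrable setT (fun x => (dot v x)%:E).
Proof.
move=> nu2; under eq_fun do rewrite /dot -sumEFin.
apply: integrable_sum => // c _; under eq_fun do rewrite EFinM.
by apply: integrableZl => //; exact: integrable_tnth.
Qed.

Lemma integral_dot nu v : finite_second_moment nu ->
  \int[nu]_x (dot v x)%:E = (dot v (mean nu))%:E.
Proof.
move=> nu2; under eq_integral do rewrite /dot -sumEFin.
rewrite integral_sum//; last first.
  move=> c; under eq_fun do rewrite EFinM.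
  by apply: integrableZl => //; exact: integrable_tnth.
rewrite -sumEFin; apply: eq_bigr => c _; under eq_integral do rewrite EFinM.
rewrite integralZl//; last exact: integrable_tnth.
rewrite EFinM tnth_mktuple fineK//.
by apply: integrable_fin_num => //; exact: integrable_tnth.
Qed.

Lemma integral_cst_prob nu (k : R) : \int[nu]__ k%:E = k%:E.
Proof.
rewrite integral_cst// -[RHS]mule1; congr (_ * _); exact: probability_setT.
Qed.

Definition second_moment nu : R := (\int[nu]_x sqnorm x)%R.

Lemma integral_sqdist nu (k : R) x : finite_second_moment nu ->
  \int[nu]_y (k * sqdist x y)%:E =
  (k * (sqnorm x - 2 * dot x (mean nu) + second_moment nu))%:E.
Proof.
move=> nu2.
have isq := integrable_sqnorm nu2.
have idot := integrable_dot x nu2.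
transitivity (\int[nu]_y ((k * sqnorm x)%:E +
    ((k * - 2)%:E * (dot x y)%:E + k%:E * (sqnorm y)%:E))).
  apply: eq_integral => y _; rewrite -!EFinM -!EFinD; congr (_%:E).
  by rewrite sqdist_expand; ring.
have i1 : nu.-integrable setT (fun y => (k * - 2)%:E * (dot x y)%:E).
  exact: integrableZl.
have i2 : nu.-integrable setT (fun y => k%:E * (sqnorm y)%:E).
  exact: integrableZl.
rewrite integralD//=; last 2 first.
- exact: integrable_cst_prob.
- exact: integrableD.
rewrite integralD// !integralZl// integral_dot// integral_cst_prob.
have -> : \int[nu]_y (sqnorm y)%:E = (second_moment nu)%:E.
  by rewrite fineK//; exact: integrable_fin_num.
by rewrite -!EFinM -!EFinD; congr (_%:E); ring.
Qed.

Lemma finite_second_moment_sqdist nu (k : R) x : (0 < k)%R ->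
  \int[nu]_y (k * sqdist x y)%:E < +oo -> finite_second_moment nu.
Proof.
move=> k0 nuk.
have msq : measurable_fun setT (fun y : E => (k * sqdist x y)%:E).
  by apply/measurable_EFinP/measurable_funM => //; exact: measurable_sqdist.
have sq0 y : 0 <= (k * sqdist x y)%:E.
  by rewrite lee_fin mulr_ge0 ?(ltW k0)// sqdistE sqnorm_ge0.
have k2 : (0 <= 2 / k)%R by rewrite divr_ge0 ?(ltW k0).
have c0 : (0 <= 2 * sqnorm x)%R by rewrite mulr_ge0 ?sqnorm_ge0.
apply: (@le_lt_trans _ _ (\int[nu]_y
    ((2 / k)%:E * (k * sqdist x y)%:E + (2 * sqnorm x)%:E))).
  apply: ge0_le_integral => //.
  - by move=> y _; rewrite lee_fin sqnorm_ge0.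
  - by apply/measurable_EFinP; exact: measurable_sqnorm.
  - by apply: emeasurable_funD => //; exact: emeasurable_funM.
  - move=> y _; rewrite -EFinM -EFinD lee_fin mulrA divfK ?gt_eqF//.
    exact: sqnorm_le_sqdist.
have p1 y : setT y -> 0 <= (2 / k)%:E * (k * sqdist x y)%:E by rewrite mule_ge0.
have m1 := emeasurable_funM (measurable_cst (2 / k)%:E) msq.
have p2 (y : E) : setT y -> 0 <= (2 * sqnorm x)%:E by rewrite lee_fin.
rewrite (ge0_integralD _ measurableT p1 m1 p2 (measurable_cst _)).
rewrite ge0_integralZl ?lee_fin// integral_cst_prob.
by rewrite lte_add_pinfty ?ltry// lte_mul_pinfty ?lee_fin.
Qed.

End Moments.

Section Wasserstein1.
Local Open Scope ereal_scope.
Context {R : realType} {d : nat}.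
Local Notation E := (euclid R d).
Implicit Types mu nu : probability E R.

Lemma measure_eq_wasserstein1 mu mu' nu nu' : mu ≡μ mu' -> nu ≡μ nu' ->
  wasserstein1 mu nu = wasserstein1 mu' nu'.
Proof.
move=> mm nn; rewrite /wasserstein1; congr (ereal_inf (image _ _)).
apply/funext => g; apply/propext; split => gC A mA.
  by rewrite -mm// -nn//; exact: gC.
by rewrite mm// nn//; exact: gC.
Qed.

Lemma wasserstein1_ge0 mu nu : 0 <= wasserstein1 mu nu.
Proof.
apply: le_ereal_inf_tmp => _ [g _ <-]; apply: integral_ge0 => z _.
by rewrite lee_fin sqrtr_ge0.
Qed.

Lemma wasserstein1_translation (m : E) mu nu :
  (forall A, measurable A -> nu A = mu (affine_map 1 m @^-1` A)) ->
  wasserstein1 nu mu <= (enorm m)%:E.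
Proof.
(* The coupling moves every point by [m], so its cost is constant. *)
move=> numu; pose f (x : E) := (affine_map 1 m x, x).
have mf : measurable_fun setT f.
  by apply/measurable_fun_pair => //; exact: measurable_affine_map.
pose fM : {mfun E >-> (E * E)%type} := HB.pack f (isMeasurableFun.Build _ _ _ _
  f mf).
pose g : probability (E * E)%type R := distribution mu fM.
apply: (@le_trans _ _ (\int[g]_z (edist z.1 z.2)%:E)).
  by apply: ereal_inf_lbound; exists g => // A mA; rewrite numu.
rewrite /g /distribution ge0_integral_pushforward//; last 2 first.
- by apply/measurable_EFinP; exact: measurable_edist.
- by move=> z _; rewrite lee_fin sqrtr_ge0.
rewrite preimage_setT.
under eq_integral => x _.
  rewrite /= (_ : edist _ _ = enorm m); last first.
    rewrite edistE; congr enorm; apply: eq_from_tnth => c.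
    by rewrite !tnth_mktuple mul1r addrAC subrr add0r.
  over.
by rewrite integral_cst_prob.
Qed.

Section Coupling.
Variables (mu nu : probability E R) (g : probability (E * E)%type R).
Hypothesis gC : coupling mu nu g.

Lemma coupling_ge0_integral (f : E -> \bar R) :
  measurable_fun setT f -> (forall x, 0 <= f x) ->
  \int[g]_z f z.1 = \int[mu]_x f x /\ \int[g]_z f z.2 = \int[nu]_x f x.
Proof.
move=> mf f0; split.
  rewrite -[LHS](@ge0_integral_pushforward _ _ _ _ _ fst _ g setT f)//.
  by apply: eq_measure_integral => A mA _; have [] := gC mA.
rewrite -[LHS](@ge0_integral_pushforward _ _ _ _ _ snd _ g setT f)//.
by apply: eq_measure_integral => A mA _; have [] := gC mA.
Qed.

Lemma coupling_integral (f : E -> \bar R) :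
  mu.-integrable setT f -> nu.-integrable setT f ->
  [/\ g.-integrable setT (fun z => f z.1), g.-integrable setT (fun z => f z.2),
   \int[g]_z f z.1 = \int[mu]_x f x & \int[g]_z f z.2 = \int[nu]_x f x].
Proof.
move=> muf nuf; have mf := measurable_int _ muf.
have [abs1 abs2] := coupling_ge0_integral (measurableT_comp (@abse_measurable _
  _) mf) (fun=> abse_ge0 _).
have g1 : g.-integrable setT (f \o fst).
  apply/integrableP; split; first exact: measurableT_comp.
  by rewrite [ltLHS]abs1; have /integrableP[] := muf.
have g2 : g.-integrable setT (f \o snd).
  apply/integrableP; split; first exact: measurableT_comp.
  by rewrite [ltLHS]abs2; have /integrableP[] := nuf.
split => //.
  rewrite -[LHS](@integral_pushforward _ _ _ _ _ fst _ g setT f)//.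
  by apply: eq_measure_integral => A mA _; have [] := gC mA.
rewrite -[LHS](@integral_pushforward _ _ _ _ _ snd _ g setT f)//.
by apply: eq_measure_integral => A mA _; have [] := gC mA.
Qed.

End Coupling.

(** The easy half of Kantorovich duality, for the linear test functions [dot v], which are Lipschitz
    with constant [enorm v]. Second moments make these functions integrable. *)
Lemma enorm_mean_le_wasserstein1 mu nu :
  finite_second_moment mu -> finite_second_moment nu ->
  (enorm (vsub (mean mu) (mean nu)))%:E <= wasserstein1 mu nu.
Proof.
move=> mu2 nu2; apply: le_ereal_inf_tmp => _ [g gC <-].
have I0 : 0 <= \int[g]_z (edist z.1 z.2)%:E.
  by apply: integral_ge0 => z _; rewrite lee_fin sqrtr_ge0.
(* A coupling of infinite cost satisfies the bound trivially; for the others the cost is a real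
   number and [edist] is integrable. *)
have [Ioo|Ioo] := eqVneq (\int[g]_z (edist z.1 z.2)%:E) +oo.
  by rewrite Ioo leey.
have Ifin : \int[g]_z (edist z.1 z.2)%:E \is a fin_num.
  by rewrite ge0_fin_numE// ltey.
have iedist : g.-integrable setT (fun z => (edist z.1 z.2)%:E).
  apply/integrableP; split; first by apply/measurable_EFinP;
    exact: measurable_edist.
  under eq_integral do rewrite /= ger0_norm ?sqrtr_ge0//.
  by rewrite ltey.
rewrite -[leRHS]fineK// lee_fin; apply: enorm_le_dual => [|v];
  first exact: fine_ge0.
have [g1 g2 e1 e2] := coupling_integral gC (integrable_dot v mu2)
  (integrable_dot v nu2).
have -> : dot v (vsub (mean mu) (mean nu)) = (dot v (mean mu) - dot v (mean
  nu))%R.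
  by rewrite -sumrB; apply: eq_bigr => c _; rewrite tnth_mktuple mulrBr.
rewrite -lee_fin EFinM fineK// EFinB -!integral_dot// -e1 -e2 -integralB//.
rewrite -integralZl//; apply: le_integral => //.
- exact: integrableB.
- exact: integrableZl.
move=> z _; rewrite -EFinB -EFinM lee_fin edistE.
apply: le_trans (dot_le_enorm _ _); rewrite -sumrB le_eqVlt; apply/orP; left;
  apply/eqP.
by apply: eq_bigr => c _; rewrite tnth_mktuple mulrBr.
Qed.

(** The product coupling and the triangle inequality. Applied to the initial factors, this makes the
    constant in the convergence rate finite. *)
Lemma wasserstein1_lty mu nu :
  \int[mu]_x (enorm x)%:E < +oo -> \int[nu]_x (enorm x)%:E < +oo ->
  wasserstein1 mu nu < +oo.
Proof.
move=> mu1 nu1.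
pose g : probability (E * E)%type R := [the probability _ _ of (mu \x nu)].
have gC : coupling mu nu g.
  move=> A mA; split.
    rewrite (_ : fst @^-1` A = A `*` setT); last first.
      by apply/seteqP; split => x //= [].
    by rewrite /g/= product_measure1E// -[RHS]mule1; congr (_ * _);
      exact: probability_setT.
  rewrite (_ : snd @^-1` A = setT `*` A); last first.
    by apply/seteqP; split => x //= [].
  by rewrite /g/= product_measure1E// -[RHS]mul1e; congr (_ * _);
    exact: probability_setT.
have menorm : measurable_fun setT (fun x : E => (enorm x)%:E).
  by apply/measurable_EFinP; exact: measurable_enorm.
have enorm0 (x : E) : 0 <= (enorm x)%:E by rewrite lee_fin enorm_ge0.
have [e1 e2] := coupling_ge0_integral gC menorm enorm0.
apply: (@le_lt_trans _ _ (\int[g]_z (edist z.1 z.2)%:E)).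
  by apply: ereal_inf_lbound; exists g.
apply: (@le_lt_trans _ _ (\int[g]_z ((enorm z.1)%:E + (enorm z.2)%:E))).
  apply: ge0_le_integral => //.
  - by move=> z _; rewrite lee_fin sqrtr_ge0.
  - by apply/measurable_EFinP; exact: measurable_edist.
  - by apply: emeasurable_funD; exact: measurableT_comp menorm _.
  - by move=> z _; rewrite -EFinD lee_fin edist_le.
rewrite ge0_integralD//; last 2 first.
- exact: measurableT_comp menorm _.
- exact: measurableT_comp menorm _.
by rewrite e1 e2 lte_add_pinfty.
Qed.

(** The law is invariant under reflection through the origin, so each coordinate of the mean equals
    its opposite. *)
Lemma gaussian_mean0 (a : R) mu : (0 < a)%R ->
  is_gaussian a [tuple 0%R | c < d] mu -> mean mu = [tuple 0%R | c < d].
Proof.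
move=> a0 mua; have mu2 := gaussian_second_moment a0 mua.
apply: eq_from_tnth => c; rewrite !tnth_mktuple.
pose phi : E -> E := affine_map (-1) [tuple 0%R | c < d].
have phiE x : tnth (phi x) c = (-1 * tnth x c)%R.
  by rewrite !tnth_mktuple addr0.
have ic := integrable_tnth c mu2.
suff : (\int[mu]_x tnth x c = \int[mu]_x (-1 * tnth x c))%R.
  by rewrite RintegralZl//; lra.
rewrite /Rintegral; congr fine.
transitivity (\int[pushforward mu phi]_x (tnth x c)%:E).
  apply: eq_measure_integral => [|mphi A mA _];
    first exact: measurable_affine_map.
  exact: (is_gaussian_affine a0 (normrN1 R) mua mua mA).
rewrite integral_pushforward//.
- by rewrite preimage_setT; apply: eq_integral => x _ /=; rewrite phiE.
- exact: measurable_affine_map.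
- by apply/measurable_EFinP; exact: measurable_tnth.
- rewrite preimage_setT (_ : _ \o _ = (fun x => (-1)%:E * (tnth x c)%:E)).
    exact: integrableZl.
  by apply/funext => x /=; rewrite phiE EFinM.
Qed.

End Wasserstein1.

(** * CAVI updates *)

Section CaviUpdate.
Local Open Scope ereal_scope.
Variables (R : realType) (n d : nat) (tau : R) (e : rel 'I_n).
Variable J : 'I_n -> 'I_n -> R.
Hypothesis tau_gt0 : (0 < tau)%R.
Hypothesis J_gt0 : forall i j, e i j -> (0 < J i j)%R.

Local Notation E := (euclid R d).
Local Notation M := (influence_mx tau e J).
Local Notation factors := ('I_n -> probability E R).
Local Notation prec := (precision tau e J).
Implicit Types nu : factors.

Lemma has_density_propto_scale (mu : probability E R) (w w' : E ->
  \bar R) (k : R) :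
  (0 < k)%R -> (forall x, w x = k%:E * w' x) ->
  has_density_propto mu w <-> has_density_propto mu w'.
Proof.
move=> k0 ww'; split=> -[c c0 muE].
  exists (c * k)%R; first exact: mulr_gt0.
  move=> A mA; apply: (eq_trans (muE A mA)); apply: eq_integral => x _.
  by rewrite ww' muleA EFinM.
exists (c / k)%R; first exact: divr_gt0.
move=> A mA; apply: (eq_trans (muE A mA)); apply: eq_integral => x _.
by rewrite ww' muleA -EFinM divfK// gt_eqF.
Qed.

(** The sum runs over all vertices: a factor outside the neighbourhood of [i] may lack a mean, but
    the default value of its integral is multiplied by 0. *)
Definition update_mean i nu : E :=
  [tuple (\sum_j M i j * tnth (mean (nu j)) c)%R | c < d].

Lemma dot_update_mean i nu v :
  dot v (update_mean i nu) = (\sum_j M i j * dot v (mean (nu j)))%R.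
Proof.
rewrite /dot; under eq_bigr do rewrite tnth_mktuple mulr_sumr.
rewrite exchange_big/=; apply: eq_bigr => j _; rewrite mulr_sumr.
by apply: eq_bigr => c _; rewrite mulrCA.
Qed.

(* Completing the square. *)
Lemma cavi_potentialE i nu : (forall j, e i j -> finite_second_moment (nu j)) ->
  exists C : R, forall x, cavi_potential tau e J i nu x =
    (prec i / 2 * sqnorm (vsub x (update_mean i nu)) + C)%:E.
Proof.
move=> nu2; have a0 := precision_gt0 tau_gt0 J_gt0 i.
exists (\sum_(j | e i j) J i j / 2 * second_moment (nu j)
        - prec i / 2 * sqnorm (update_mean i nu))%R => x.
rewrite /cavi_potential.
under eq_bigr => j eij do rewrite (integral_sqdist _ _ (nu2 j eij)).
rewrite sumEFin -EFinD; congr (_%:E).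
rewrite -sqdistE sqdist_expand.
have prec_dot : (prec i * dot x (update_mean i nu) =
    \sum_(j | e i j) J i j * dot x (mean (nu j)))%R.
  rewrite dot_update_mean mulr_sumr [RHS]big_mkcond; apply: eq_bigr => j _.
  rewrite mxE; case: ifP => _; last by rewrite mul0r mulr0.
  by rewrite -/(precision tau e J i); field; rewrite gt_eqF.
transitivity (tau / 2 * sqnorm x + (\sum_(l | e i l) J i l) / 2 * sqnorm x -
    \sum_(j | e i j) J i j * dot x (mean (nu j)) +
    \sum_(j | e i j) J i j / 2 * second_moment (nu j))%R.
  rewrite -!addrA; congr (_ + _)%R; rewrite !mulr_suml -sumrN -!big_split/=.
  by apply: eq_bigr => j _; field.
by rewrite -prec_dot /precision; field.
Qed.

(** One neighbour with infinite second moment makes the potential [+oo] at every point, so the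
    density vanishes and cannot have mass 1. *)
Lemma cavi_update_second_moment i nu mu : is_cavi_update tau e J i nu mu ->
  forall j, e i j -> finite_second_moment (nu j).
Proof.
move=> [c c0 muE] j eij; apply: contrapT => nuj.
have term0 k x : e i k -> 0 <= \int[nu k]_y (J i k / 2 * sqdist x y)%:E.
  move=> eik; apply: integral_ge0 => y _.
  rewrite lee_fin mulr_ge0//; last by rewrite sqdistE sqnorm_ge0.
  by rewrite divr_ge0// ltW// J_gt0.
have Vy x : cavi_potential tau e J i nu x = +oo.
  rewrite /cavi_potential (bigD1 j)//=.
  have -> : \int[nu j]_y (J i j / 2 * sqdist x y)%:E = +oo.
    apply/eqP; apply: contra_notT nuj; rewrite -ltey.
    by apply: finite_second_moment_sqdist; rewrite divr_gt0 ?J_gt0.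
  rewrite addye ?addey// gt_eqF// (lt_le_trans ltNy0)//.
  by apply: sume_ge0 => k /andP[eik _]; exact: term0.
have := muE _ measurableT; rewrite probability_setT.
under eq_integral do rewrite Vy /= mule0.
by rewrite integral0 => /eqP; rewrite onee_eq0.
Qed.

Lemma cavi_update_gaussian i nu mu :
  (forall j, e i j -> finite_second_moment (nu j)) ->
  is_cavi_update tau e J i nu mu <-> is_gaussian (prec i) (update_mean i nu) mu.
Proof.
move=> /cavi_potentialE[C VE].
apply: (@has_density_propto_scale _ _ _ (expR (- C))); first exact: expR_gt0.
by move=> x; rewrite VE/= -EFinM /gaussian -expRD opprD addrC.
Qed.

Variable mus : factors.
Hypothesis musP : forall i, is_gaussian (prec i) [tuple 0%R | c < d] (mus i).

Lemma mus_second_moment i : finite_second_moment (mus i).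
Proof. exact: gaussian_second_moment (precision_gt0 tau_gt0 J_gt0 i) (musP i).
  Qed.

Lemma mus_mean i : mean (mus i) = [tuple 0%R | c < d].
Proof. exact: gaussian_mean0 (precision_gt0 tau_gt0 J_gt0 i) (musP i). Qed.

Lemma cavi_fixed_point_mus : cavi_fixed_point tau e J mus.
Proof.
move=> i; apply/cavi_update_gaussian; first by move=> j _;
  exact: mus_second_moment.
rewrite (_ : update_mean _ _ = [tuple 0%R | c < d])//.
apply: eq_from_tnth => c; rewrite !tnth_mktuple big1// => j _.
by rewrite mus_mean tnth_mktuple mulr0.
Qed.

(** The precision at [i] does not depend on the other factors, so all updates of [i] are translates
    of a single law. *)
Lemma cavi_updateE i nu mu : is_cavi_update tau e J i nu mu ->
  forall A, measurable A ->
    mu A = mus i (affine_map 1 (update_mean i nu) @^-1` A).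
Proof.
move=> upd; have nu2 := cavi_update_second_moment upd.
move/(cavi_update_gaussian _ nu2): upd => mug.
by apply: (is_gaussian_affine _ _ (musP i) mug);
  rewrite ?normr1// precision_gt0.
Qed.

(** Updates are specified by a relation; this says that it is functional up to equality on
    measurable sets, as the random scan requires. *)
Lemma cavi_update_unique i nu nu' mu mu' :
  is_cavi_update tau e J i nu mu -> is_cavi_update tau e J i nu' mu' ->
  (forall j, nu j ≡μ nu' j) -> mu ≡μ mu'.
Proof.
move=> upd upd' nn A mA; apply: (eq_trans (cavi_updateE upd mA)).
apply: (eq_trans _ (esym (cavi_updateE upd' mA))).
congr (mus i (affine_map 1 _ @^-1` A)); apply: eq_from_tnth => c.
rewrite !tnth_mktuple; apply: eq_bigr => j _.
by rewrite (measure_eq_mean (nn j)).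
Qed.

Lemma cavi_update_wasserstein i nu mu : is_cavi_update tau e J i nu mu ->
  wasserstein1 mu (mus i) <= (enorm (update_mean i nu))%:E.
Proof. by move=> upd; apply: wasserstein1_translation; exact: cavi_updateE. Qed.

Lemma enorm_update_mean i nu : (forall j, e i j ->
  finite_second_moment (nu j)) ->
  (enorm (update_mean i nu))%:E <= emulmx M (wasserstein_vec nu mus) i.
Proof.
move=> nu2; apply: (@le_trans _ _ (\sum_j M i j * enorm (mean (nu j)))%:E).
  rewrite lee_fin; apply: enorm_le_dual => [|v].
    by apply: sumr_ge0 => j _; rewrite mulr_ge0 ?enorm_ge0// influence_mx_ge0.
  rewrite dot_update_mean mulr_sumr; apply: ler_sum => j _; rewrite mulrCA.
  by rewrite ler_wpM2l ?influence_mx_ge0 ?dot_le_enorm.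
rewrite -sumEFin; apply: lee_sum => j _; rewrite EFinM.
(* For a non-neighbour the coefficient is 0, and its product with the distance is 0 even if that
   distance is [+oo]. *)
have [eij|eij] := boolP (e i j); last by rewrite mxE (negbTE eij) !mul0e.
apply: lee_wpmul2l; first by rewrite lee_fin influence_mx_ge0.
apply: le_trans (enorm_mean_le_wasserstein1 (nu2 _ eij) (mus_second_moment j)).
rewrite lee_fin le_eqVlt; apply/orP; left; apply/eqP; congr enorm.
by apply: eq_from_tnth => c; rewrite mus_mean !tnth_mktuple subr0.
Qed.

Lemma cavi_update_contraction i nu mu : is_cavi_update tau e J i nu mu ->
  wasserstein1 mu (mus i) <= emulmx M (wasserstein_vec nu mus) i.
Proof.
move=> upd; apply: le_trans (cavi_update_wasserstein upd) _.
exact/enorm_update_mean/(cavi_update_second_moment upd).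
Qed.

Lemma wasserstein1_fin_num (mu nu : probability E R) (r : R) :
  wasserstein1 mu nu <= r%:E -> wasserstein1 mu nu \is a fin_num.
Proof.
move=> le_r; rewrite ge0_fin_numE ?wasserstein1_ge0//.
exact: le_lt_trans le_r (ltry _).
Qed.

Lemma admissible_fin_num mu i : admissible_factor mu ->
  wasserstein1 mu (mus i) \is a fin_num.
Proof.
move=> [_ mu1]; rewrite ge0_fin_numE ?wasserstein1_ge0//.
apply: wasserstein1_lty => //.
have /integrableP[_] := integrable_enorm (mus_second_moment i).
by under eq_integral do rewrite /= ger0_norm ?enorm_ge0//.
Qed.

Lemma cavi_update_fin_num i nu mu : is_cavi_update tau e J i nu mu ->
  wasserstein1 mu (mus i) \is a fin_num.
Proof. by move=> /cavi_update_wasserstein/wasserstein1_fin_num. Qed.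

Lemma emulmxE (A : 'M[R]_n) (w : 'I_n -> \bar R) i :
  (forall j, w j \is a fin_num) ->
  emulmx A w i = (\sum_j A i j * fine (w j))%:E.
Proof.
move=> wfin; rewrite -sumEFin; apply: eq_bigr => j _.
by rewrite EFinM fineK.
Qed.

(** At a vertex of largest distance the contraction by [q < 1] forces that distance to be 0.
    Equality of the measures then follows because all update means vanish, so each factor is the
    trivial translate of [mus i]. *)
Lemma cavi_fixed_point_unique nu : cavi_fixed_point tau e J nu ->
  forall i, nu i ≡μ mus i.
Proof.
move=> nuP i.
pose w j := fine (wasserstein1 (nu j) (mus j)).
(* Each factor of a fixed point is itself an update, hence at finite distance. *)
have wfin j : wasserstein1 (nu j) (mus j) \is a fin_num.
  exact: cavi_update_fin_num (nuP j).
have w0 j : (0 <= w j)%R by rewrite fine_ge0// wasserstein1_ge0.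
have [q [q0 q1 Mq]] := influence_mx_row_sum tau_gt0 J_gt0.
pose j := [arg max_(j > i) w j]%O.
have jmax k : (w k <= w j)%R by rewrite /j; case: arg_maxP => // l _; exact.
have wj : (w j <= q * w j)%R.
  apply: (@le_trans _ _ (\sum_k M j k * w k)%R).
    rewrite -lee_fin fineK//; apply: le_trans (cavi_update_contraction (nuP j))
      _.
    by rewrite emulmxE.
  apply: (@le_trans _ _ (\sum_k M j k * w j)%R).
    by apply: ler_sum => k _; rewrite ler_wpM2l// influence_mx_ge0.
  by rewrite -mulr_suml ler_wpM2r.
have {}wj : w j = 0%R.
  apply/eqP; rewrite eq_le w0 andbT.
  have : ((1 - q) * w j <= 0)%R by rewrite mulrBl mul1r subr_le0.
  by rewrite pmulr_rle0// subr_gt0.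
have wk k : wasserstein1 (nu k) (mus k) = 0.
  rewrite -[LHS]fineK//; congr (_%:E); apply/eqP.
  by rewrite eq_le w0 andbT -wj jmax.
have m0 : update_mean i nu = [tuple 0%R | c < d].
  have : (enorm (update_mean i nu))%:E <= 0.
    apply: le_trans (enorm_update_mean (cavi_update_second_moment (nuP i))) _.
    by rewrite /emulmx big1// => k _; rewrite /wasserstein_vec wk mule0.
  rewrite lee_fin => m0; apply: eq_from_tnth => c; rewrite [RHS]tnth_mktuple.
  by apply/eqP; rewrite -normr_le0; exact: le_trans (tnth_le_enorm _ _) m0.
move=> A mA; apply: (eq_trans (cavi_updateE (nuP i) mA)); rewrite m0;
  congr (mus i _).
rewrite (_ : affine_map _ _ = id) ?preimage_id//; apply/funext => x.
by apply: eq_from_tnth => c; rewrite !tnth_mktuple mul1r addr0.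
Qed.

Lemma wasserstein_rate (A : 'M[R]_n) (W : nat -> 'I_n -> \bar R) :
  (forall i j, 0 <= A i j)%R -> (forall k i, W k i \is a fin_num) ->
  (forall i, 0 <= W 0%N i) ->
  (forall k, lee_vec (W k.+1) (emulmx A (W k))) ->
  converges_at_rate (spectral_radius A) W.
Proof.
move=> A0 Wfin W0 WA r Ar.
have [||C hC] := linear_recurrence_rate (w :=
  fun k i => fine (W k i)) A0 _ _ Ar.
- by move=> i; rewrite fine_ge0.
- by move=> k i; rewrite -lee_fin fineK// -(emulmxE A i (Wfin k)); exact: WA.
by exists C => k i; rewrite -[W k i]fineK// lee_fin.
Qed.

Lemma parallel_cavi_converges (mu : nat -> factors) :
  (forall i, admissible_factor (mu 0%N i)) -> parallel_cavi tau e J mu ->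
  (forall k, lee_vec (wasserstein_vec (mu k.+1) mus)
                     (emulmx M (wasserstein_vec (mu k) mus))) /\
  converges_at_rate (spectral_radius M) (fun k => wasserstein_vec (mu k) mus).
Proof.
move=> mu0 muP.
have step k : lee_vec (wasserstein_vec (mu k.+1) mus)
                     (emulmx M (wasserstein_vec (mu k) mus)).
  by move=> i; exact: cavi_update_contraction (muP k i).
split => //; apply: wasserstein_rate => //.
- by move=> i j; exact: influence_mx_ge0.
- case=> [|k] i; first exact: admissible_fin_num.
  exact: cavi_update_fin_num (muP k i).
- by move=> i; exact: wasserstein1_ge0.
Qed.

Hypothesis e_irr : irreflexive e.

Lemma sequential_cavi_converges (mu : nat -> factors) :
  (forall i, admissible_factor (mu 0%N i)) -> sequential_cavi tau e J mu ->
  (forall k, lee_vec (wasserstein_vec (mu k.+1) mus)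
      (emulmx (sequential_mx tau e J) (wasserstein_vec (mu k) mus))) /\
  converges_at_rate (spectral_radius (sequential_mx tau e J))
    (fun k => wasserstein_vec (mu k) mus).
Proof.
move=> mu0 muP.
have Wfin k i : wasserstein_vec (mu k) mus i \is a fin_num.
  case: k => [|k]; first exact: admissible_fin_num.
  exact: cavi_update_fin_num (muP k i).
have step k : lee_vec (wasserstein_vec (mu k.+1) mus)
    (emulmx (sequential_mx tau e J) (wasserstein_vec (mu k) mus)).
  move=> i; rewrite emulmxE// -[leLHS]fineK// lee_fin.
  (* Within a sweep, vertex [i] sees new factors below [i] and old ones above, so the contraction
     has [L] acting on the new distances and [U] on the old. *)
  apply: (sequential_mx_le tau_gt0 J_gt0
    (x := fun i => fine (wasserstein_vec (mu k.+1) mus i))) => {}i.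
  rewrite -lee_fin fineK//.
  apply: le_trans (cavi_update_contraction (muP k i)) _.
  rewrite emulmxE; last by move=> j; rewrite /wasserstein_vec; case: ifP => _;
    exact: Wfin.
  rewrite lee_fin le_eqVlt; apply/orP; left; apply/eqP.
  rewrite influence_split ?influence_mx_diag//; congr (_ + _)%R.
    by apply: eq_bigr => j _; rewrite !mxE /wasserstein_vec; case: ifP;
      rewrite ?mul0r.
  apply: eq_bigr => j _; rewrite !mxE /wasserstein_vec.
  by case: ltngtP; rewrite ?mul0r.
split => //; apply: wasserstein_rate => //.
- by move=> i j; exact: sequential_mx_ge0.
- by move=> i; exact: wasserstein1_ge0.
Qed.

End CaviUpdate.

(** * Random scan *)

Section RandomScanCavi.
Local Open Scope ereal_scope.
Variables (R : realType) (n d : nat) (tau : R) (e : rel 'I_n).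
Variable J : 'I_n -> 'I_n -> R.
Hypothesis tau_gt0 : (0 < tau)%R.
Hypothesis J_gt0 : forall i j, e i j -> (0 < J i j)%R.

Local Notation E := (euclid R d).
Local Notation factors := ('I_n -> probability E R).
Local Notation M := (random_scan_mx tau e J).

Variable mus : factors.
Hypothesis musP : forall i, is_gaussian (precision tau e J i) [tuple 0%R | c <
  d] (mus i).

Variables (dO : measure_display) (Omega : measurableType dO).
Variables (P : probability Omega R) (I : nat -> Omega -> 'I_n).
Variables (mu0 : factors) (mu : nat -> Omega -> factors).
Hypothesis I_unif : uniform_draws P I.
Hypothesis I_indep : independent_draws P I.
Hypothesis mu0_adm : forall i, admissible_factor (mu0 i).
Hypothesis muP : random_scan_cavi tau e J I mu0 mu.

(** The possible values of the first [k] draws, nested so that one more draw is a pairing;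
    finiteness turns integrals into sums. *)
Fixpoint history (k : nat) : finType :=
  match k return finType with
  | 0 => unit : finType
  | k'.+1 => (history k' * 'I_n)%type : finType
  end.

Fixpoint past (k : nat) (om : Omega) : history k :=
  match k return history k with
  | 0 => tt
  | k'.+1 => (past k' om, I k' om)
  end.

(** Puts the event of a given history in the form to which [independent_draws] and [uniform_draws]
    apply. *)
Lemma past_event k (h : history k) : exists2 B : nat -> set 'I_n,
  past k @^-1` [set h] = \bigcap_(j in [set` iota 0 k]) (I j @^-1` B j) &
  forall j, (j < k)%N -> exists i, B j = [set i].
Proof.
elim: k h => [|k IHk] h.
  exists (fun=> setT) => //; apply/seteqP; split => [om _ j //|om _ /=].
  by case: (h).
case: h => h i; have [B BE Bk] := IHk h.
exists (fun j => if j == k then [set i] else B j); last first.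
  move=> j; rewrite ltnS leq_eqVlt; case: eqP => [_ _|_ /= jk];
    first by exists i.
  exact: Bk.
have iotaE m j : [set` iota 0 m] j = (j < m)%N :> Prop.
  by rewrite -[LHS]/(is_true (j \in iota 0 m)) mem_iota.
have BE' om : past k om = h <-> (forall j, (j < k)%N -> B j (I j om)).
  have -> : (past k om = h) = (past k @^-1` [set h]) om by [].
  by rewrite BE; split=> H j jk; apply: H; move: jk; rewrite iotaE.
apply/seteqP; split => om.
  move=> [hom iom] j; rewrite iotaE ltnS => jk /=.
  case: eqP => [->//|/eqP jk']; apply: (BE' om).1 => //.
  by rewrite ltn_neqAle jk'.
move=> H.
have {}H j : (j < k.+1)%N -> (if j == k then [set i] else B j) (I j om).
  by move=> jk; apply: H; rewrite iotaE.
apply/pair_equal_spec; split; last by have := H k (ltnSn k); rewrite eqxx.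
by apply/BE' => j jk; have := H j (ltnW jk); rewrite ltn_eqF.
Qed.

Local Notation p := (n%:R^-1 : R)%R.

Lemma measurable_past k (h : history k) : measurable (past k @^-1` [set h]).
Proof.
have [B -> Bk] := past_event h; apply: fin_bigcap_measurable => // j /=.
rewrite mem_iota add0n => /Bk[i ->].
by have [] := I_unif j i.
Qed.

Lemma past_prob k (h : history k) : P (past k @^-1` [set h]) = (p ^+ k)%:E.
Proof.
have [B -> Bk] := past_event h; rewrite I_indep ?iota_uniq//.
transitivity (\prod_(0 <= j < k) p%:E).
  rewrite /index_iota subn0; apply: eq_big_seq => j.
  rewrite mem_iota add0n => /Bk[i ->].
  by have [] := I_unif j i.
elim: (k) => [|m IHm]; first by rewrite big_geq// expr0.
by rewrite big_nat_recr//= IHm exprSr EFinM.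
Qed.

Lemma n_gt0 : (0 < n)%N.
Proof.
have : P setT != 0 by rewrite probability_setT onee_eq0.
move=> P0; have [om _] : [set: Omega] !=set0.
  by apply/set0P; apply: contra_neq P0 => ->; rewrite measure0.
exact: leq_ltn_trans (leq0n _) (ltn_ord (I 0%N om)).
Qed.

Lemma p_gt0 : (0 < p)%R.
Proof. by rewrite invr_gt0 ltr0n n_gt0. Qed.

(** A history has positive probability, hence occurs. The chosen outcome allows quantities defined
    on [Omega] to be evaluated on histories. *)
Lemma past_surj k (h : history k) : {om | past k om = h}.
Proof.
apply: cid; have : P (past k @^-1` [set h]) != 0.
  by rewrite past_prob gt_eqF// lte_fin exprn_gt0// p_gt0.
move=> P0; have [om] : past k @^-1` [set h] !=set0.
  by apply/set0P; apply: contra_neq P0 => ->; rewrite measure0.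
by exists om.
Qed.

Definition rep k (h : history k) : Omega := projT1 (past_surj h).

Lemma past_rep k (h : history k) : past k (rep h) = h.
Proof. exact: projT2 (past_surj h). Qed.

Lemma integral_past k (S : pred (history k)) (f : history k -> R) :
  (forall h, 0 <= f h)%R ->
  \int[P]_(om in [set om | S (past k om)]) (f (past k om))%:E =
  (\sum_(h | S h) p ^+ k * f h)%:E.
Proof.
move=> f0; rewrite integral_mkcond.
transitivity (\int[P]_om (\sum_(h <- enum (history k) | S h)
    (f h)%:E * (\1_(past k @^-1` [set h]) om)%:E)).
  apply: eq_integral => om _; rewrite patchE big_enum_cond/=.
  have [Som|nSom] := boolP (S (past k om)).
    rewrite ifT ?mem_set// (bigD1 (past k om))//= big1 => [|h /andP[_ hom]].
      by rewrite indicE mem_set// mule1 adde0.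
    by rewrite indicE memNset ?mule0//= => /eqP; rewrite eq_sym (negbTE hom).
  rewrite ifF; last by apply/negbTE; apply: contraNN nSom => /set_mem.
  rewrite big1// => h Sh; rewrite indicE memNset ?mule0//= => hom.
  by move: nSom; rewrite hom Sh.
under eq_integral do rewrite -big_filter.
rewrite ge0_integral_sum//; last 2 first.
- move=> h; apply: emeasurable_funM => //; apply/measurable_EFinP.
  by apply: measurable_indic; exact: measurable_past.
- by move=> h om _; rewrite mule_ge0 ?lee_fin.
rewrite big_filter big_enum_cond -sumEFin; apply: eq_bigr => h _.
rewrite ge0_integralZl ?lee_fin//; last first.
  by apply/measurable_EFinP; apply: measurable_indic; exact: measurable_past.
rewrite integral_indic//; last exact: measurable_past.
by rewrite setIT mulrC EFinM; congr (_ * _); exact: past_prob.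
Qed.

(** Equality on measurable sets is all that [sigma_factors] observes, so these classes will be its
    atoms. *)
Definition same_factors k om om' := forall i, mu k om i ≡μ mu k om' i.

Lemma same_factors_sym k om om' : same_factors k om om' ->
  same_factors k om' om.
Proof. by move=> s i A mA; rewrite s. Qed.

Lemma same_factors_trans k om1 om2 om3 : same_factors k om1 om2 ->
  same_factors k om2 om3 -> same_factors k om1 om3.
Proof. by move=> s t i A mA; rewrite s// t. Qed.

Lemma same_factorsS k om om' : same_factors k om om' -> I k om = I k om' ->
  same_factors k.+1 om om'.
Proof.
move=> s II i; have [upd keep] := muP.2 k om; have [upd' keep'] := muP.2 k om'.
have [->|iI] := eqVneq i (I k om).
  rewrite -II in upd'; exact: (cavi_update_unique tau_gt0 J_gt0 musP upd upd').
by rewrite keep// keep'// -II.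
Qed.

Lemma past_same_factors k om om' : past k om = past k om' ->
  same_factors k om om'.
Proof.
elim: k => [_ i|k IHk [hh II]]; last by apply: same_factorsS => //; exact: IHk.
by rewrite !muP.1.
Qed.

Local Notation W := (fun k om => wasserstein_vec (mu k om) mus).

Lemma same_factors_wasserstein k om om' i : same_factors k om om' ->
  W k om i = W k om' i.
Proof. by move=> s; apply: measure_eq_wasserstein1 => //; exact: s. Qed.

Lemma random_scan_fin_num k om i : W k om i \is a fin_num.
Proof.
elim: k => [|k IHk].
  by rewrite muP.1; apply: (admissible_fin_num tau_gt0 J_gt0 musP).
have [upd keep] := muP.2 k om.
have [->|iI] := eqVneq i (I k om).
  exact: (cavi_update_fin_num tau_gt0 J_gt0 musP upd).
by rewrite /wasserstein_vec keep.
Qed.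

Definition past_wasserstein k i (h : history k) : R := fine (W k (rep h) i).
Local Notation w := past_wasserstein.

Lemma past_wassersteinE k om i : W k om i = (w i (past k om))%:E.
Proof.
rewrite fineK ?random_scan_fin_num//; apply: same_factors_wasserstein.
by apply: past_same_factors; rewrite past_rep.
Qed.

Lemma past_wasserstein_ge0 k i (h : history k) : (0 <= w i h)%R.
Proof. by rewrite fine_ge0// wasserstein1_ge0. Qed.

(** The candidate conditional expectation: the average over the next draw, with the history held
    fixed. *)
Definition mean_step k i (h : history k) : R :=
  (\sum_(i' < n) p * w i ((h, i') : history k.+1))%R.

Lemma mean_step_ge0 k i (h : history k) : (0 <= mean_step i h)%R.
Proof.
by apply: sumr_ge0 => j _; rewrite mulr_ge0 ?(ltW p_gt0) ?past_wasserstein_ge0.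
Qed.

(** The draw of [i] contributes the contraction with weight [1/n]; the other [n - 1] draws leave
    factor [i] unchanged. *)
Lemma mean_step_le k i (h : history k) :
  (mean_step i h <= \sum_j M i j * w j h)%R.
Proof.
have wkeep i' : i' != i -> w i ((h, i') : history k.+1) = w i h.
  move=> i'i; pose om := rep ((h, i') : history k.+1).
  have [hom iom] : past k om = h /\ I k om = i'.
    by have [] := past_rep ((h, i') : history k.+1).
  apply/EFin_inj; rewrite -[in RHS]hom -past_wassersteinE.
  rewrite /past_wasserstein fineK ?random_scan_fin_num//.
  by rewrite /wasserstein_vec (muP.2 k om).2// iom eq_sym.
have wupd : (w i ((h, i) : history k.+1) <=
    \sum_j influence_mx tau e J i j * w j h)%R.
  pose om := rep ((h, i) : history k.+1).
  have [hom iom] : past k om = h /\ I k om = i.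
    by have [] := past_rep ((h, i) : history k.+1).
  rewrite -lee_fin /past_wasserstein fineK ?random_scan_fin_num//.
  have := (muP.2 k om).1; rewrite iom => upd.
  apply: le_trans (cavi_update_contraction tau_gt0 J_gt0 musP upd) _.
  rewrite emulmxE; last by move=> j; exact: random_scan_fin_num.
  rewrite lee_fin le_eqVlt; apply/orP; left; apply/eqP; apply: eq_bigr => j _.
  by rewrite past_wassersteinE hom.
rewrite /mean_step (bigD1 i)//=.
under eq_bigr => i' i'i do rewrite wkeep//.
rewrite sumr_const cardC1 card_ord.
have -> : (\sum_j M i j * w j h = p * (\sum_j influence_mx tau e J i j * w j h)
    + (n%:R - 1) / n%:R * w i h)%R.
  transitivity (\sum_j (p * (influence_mx tau e J i j * w j h) +
      (n%:R - 1) / n%:R * ((i == j)%:R * w j h)))%R.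
    by apply: eq_bigr => j _; rewrite random_scan_mxE; ring.
  rewrite big_split/= -!mulr_sumr; congr (_ + _ * _)%R.
  rewrite (bigD1 i)//= eqxx mul1r big1 ?addr0// => j /negbTE.
  by rewrite eq_sym => ->; rewrite mul0r.
rewrite lerD ?ler_wpM2l ?(ltW p_gt0)//.
rewrite le_eqVlt; apply/orP; left; apply/eqP.
have -> : (n%:R - 1 = n.-1%:R :> R)%R by rewrite -subn1 natrB ?n_gt0.
by rewrite -[LHS]mulr_natl mulrA.
Qed.

Lemma sum_historyS k (S : pred (history k)) (F : history k.+1 -> R) :
  (\sum_(h | S h.1) F h = \sum_(h | S h) \sum_(i < n) F (h, i))%R.
Proof.
rewrite (pair_big S predT (fun h i => F (h, i)))/=.
by apply: eq_big => [q|[]//]; rewrite andbT.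
Qed.

(** * Conditional expectation given the current factors *)

Section Step.
Variable k : nat.

Local Notation G := (sigma_factors (mu k)).

(** The saturated sets form a sigma-algebra that contains the generators. *)
Lemma sigma_factors_saturated A : G A ->
  forall om om', same_factors k om om' -> A om -> A om'.
Proof.
pose H : set (set Omega) :=
  [set A | forall om om', same_factors k om om' -> A om -> A om'].
suff : G `<=` H by move=> GH /GH.
apply: smallest_sub; first split.
- by move=> om om' _ [].
- move=> B HB om om' s [_ nB]; split => // Bom'; apply: nB.
  exact: HB (same_factors_sym s) Bom'.
- move=> F HF om om' s [j _ Fj]; exists j => //; exact: HF Fj.
move=> _ [i _ [B mB [Y mY <-]]] om om' s [_ /= Yom]; split => //=.
by rewrite -(s i _ mB).
Qed.

Lemma sigma_factors_past A : G A -> exists S : pred (history k),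
  A = [set om | S (past k om)].
Proof.
move=> GA; exists (fun h => `[< A (rep h) >]); apply/seteqP; split => om /=.
  move=> Aom; apply/asboolP; apply: sigma_factors_saturated Aom => //.
  by apply: past_same_factors; rewrite past_rep.
move=> /asboolP; apply: sigma_factors_saturated => //.
by apply: past_same_factors; rewrite past_rep.
Qed.

Lemma measurable_past_pred (S : pred (history k)) :
  measurable [set om | S (past k om)].
Proof.
rewrite (_ : [set _ | _] = \bigcup_(h in [set h | S h]) (past k @^-1` [set h])).
  by apply: fin_bigcup_measurable => // h _; exact: measurable_past.
by apply/seteqP; split => [om Som|om [h Sh /= ->]//]; exists (past k om).
Qed.

Lemma sigma_factors_measurable A : G A -> measurable A.
Proof. by move=> /sigma_factors_past[S ->]; exact: measurable_past_pred. Qed.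

(* Finitely many histories have to be told apart, and each one is excluded by
   the mass of a single measurable set. *)
Lemma sigma_factors_atom om : G [set om' | same_factors k om om'].
Proof.
have sep (h : history k) : exists C, [/\ G C,
    forall om', same_factors k om om' -> C om' &
    forall om', past k om' = h -> C om' -> same_factors k om om'].
  have [[omh [hh ns]]|none] :=
      pselect (exists omh, past k omh = h /\ ~ same_factors k om omh);
        last first.
    exists setT; split => //; first exact: (@measurableT _ (g_sigma_algebraType
      _)).
    by move=> om' hom' _; apply: contrapT => ns; apply: none; exists om'.
  move/existsNP : ns => [i /existsNP[A /not_implyP[mA neq]]].
  exists ((fun om' => mu k om' i A) @^-1` [set mu k om i A]); split.
  - apply: sub_sigma_algebra; exists i => //; exists A => //.
    exists [set mu k om i A]; first exact: emeasurable_set1.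
    by rewrite setTI.
  - by move=> om' s /=; rewrite s.
  - move=> om' hom' /= eqA; exfalso; apply: neq.
    exact: (eq_trans (esym eqA) (past_same_factors (etrans hom' (esym hh)) _
      mA)).
have [C CP] := choice sep.
rewrite (_ : [set _ | _] = \bigcap_(h in setT) C h).
  apply: (@fin_bigcap_measurable _ (g_sigma_algebraType _)) => //.
  by move=> h _; have [] := CP h.
apply/seteqP; split => om' /=; first by move=> s h _; have [_ + _] := CP h;
  apply.
by move=> H; have [_ _] := CP (past k om'); apply => //; exact: H.
Qed.

Variable i : 'I_n.

(** The Markov property: although defined from the whole history, [mean_step] depends only on the
    current factors. It is thus measurable for their possibly coarser sigma-algebra. *)
Lemma same_factors_mean_step om om' : same_factors k om om' ->
  mean_step i (past k om) = mean_step i (past k om').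
Proof.
move=> s; apply: eq_bigr => i' _; congr (_ * _)%R.
apply/EFin_inj; rewrite /past_wasserstein !fineK ?random_scan_fin_num//.
have [h1 i1] := past_rep ((past k om, i') : history k.+1).
have [h2 i2] := past_rep ((past k om', i') : history k.+1).
apply: same_factors_wasserstein; apply: same_factorsS; last by rewrite i1 i2.
apply: same_factors_trans (past_same_factors h1) _.
exact: same_factors_trans s (same_factors_sym (past_same_factors h2)).
Qed.

Lemma cond_expectation_mean_step :
  is_cond_expectation P G (fun om => W k.+1 om i)
    (fun om => (mean_step i (past k om))%:E).
Proof.
split=> [B mB|A /sigma_factors_past[S ->]].
  have -> : (fun om => (mean_step i (past k om))%:E) @^-1` B =
      \bigcup_(h in [set h : history k | B (mean_step i h)%:E])
        [set om | same_factors k (rep h) om]; last first.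
    apply: (@fin_bigcup_measurable _ (g_sigma_algebraType _)) => // h _.
    exact: sigma_factors_atom.
  apply/seteqP; split => [om Bom|om [h /= Bh /same_factors_mean_step <-]].
    exists (past k om) => //=.
    by apply: past_same_factors; rewrite past_rep.
  by rewrite past_rep.
rewrite integral_past; last exact: mean_step_ge0.
under [RHS]eq_integral do rewrite past_wassersteinE.
(* The same event is described by histories of length [k.+1], through their first component; the
   extra factor [p] is the weight of the last draw. *)
rewrite [RHS](@integral_past k.+1 (fun h => S h.1));
  last exact: past_wasserstein_ge0.
congr (_%:E); rewrite sum_historyS.
apply: eq_bigr => h _; rewrite mulr_sumr; apply: eq_bigr => i' _.
by rewrite mulrA exprSr.
Qed.

(** Any version is constant on the atom of [om], whose probability is positive since it contains the
    event of a whole history. Integrating over this atom determines the value. *)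
Lemma cond_expectation_unique Y :
  is_cond_expectation P G (fun om => W k.+1 om i) Y ->
  forall om, Y om = (mean_step i (past k om))%:E.
Proof.
move=> [mY intY] om; have [_ intZ] := cond_expectation_mean_step.
pose B := [set om' | same_factors k om om'].
have GB : G B by exact: sigma_factors_atom.
have mB := sigma_factors_measurable GB.
have Yc om' : B om' -> Y om' = Y om.
  move=> s; have mY1 := mY _ (emeasurable_set1 (Y om)).
  exact: (sigma_factors_saturated mY1 s).
have PB : 0 < P B.
  apply: (@lt_le_trans _ _ (P (past k @^-1` [set past k om]))).
    by rewrite past_prob lte_fin exprn_gt0// p_gt0.
  apply: le_measure; rewrite ?inE//; first exact: measurable_past.
  by move=> om' /= hh; apply: past_same_factors.
have PBfin : P B \is a fin_num by exact: fin_num_measure.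
have : Y om * P B = (mean_step i (past k om))%:E * P B.
  rewrite -!integral_cst//.
  transitivity (\int[P]_(x in B) Y x).
    by apply: eq_integral => om' /[!inE] /Yc ->.
  rewrite (intY _ GB) -(intZ _ GB); apply: eq_integral => om' /[!inE] s.
  by rewrite (same_factors_mean_step s).
move: PB; rewrite -(fineK PBfin) lte_fin => PB0.
move/(congr1 (fun x => x * (fine (P B))^-1%:E)).
by rewrite -!muleA -EFinM divff ?gt_eqF// !mule1.
Qed.

Lemma random_scan_conditional :
  (exists Y, is_cond_expectation P G (fun om => W k.+1 om i) Y) /\
  forall Y, is_cond_expectation P G (fun om => W k.+1 om i) Y ->
    {ae P, forall om, Y om <= emulmx M (W k om) i}.
Proof.
split; first by exists (fun om => (mean_step i (past k om))%:E);
  exact: cond_expectation_mean_step.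
move=> Y /cond_expectation_unique YE; apply: aeW => om.
rewrite YE emulmxE; last by move=> j; exact: random_scan_fin_num.
rewrite lee_fin; apply: le_trans (mean_step_le _ _) _.
by apply: ler_sum => j _; rewrite past_wassersteinE.
Qed.

End Step.

Lemma integral_wasserstein k i :
  \int[P]_om W k om i = (\sum_h p ^+ k * w i (h : history k))%:E.
Proof.
under eq_integral do rewrite past_wassersteinE.
rewrite -(integral_past predT); last exact: past_wasserstein_ge0.
by congr (integral _ _ _); apply/seteqP; split.
Qed.

Lemma random_scan_rate :
  converges_at_rate (spectral_radius M) (fun k i => \int[P]_om W k om i).
Proof.
apply: wasserstein_rate => //.
- by move=> i j; exact: random_scan_mx_ge0.
- by move=> k i; rewrite integral_wasserstein.
- by move=> i; apply: integral_ge0 => om _; exact: wasserstein1_ge0.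
move=> k i; rewrite emulmxE; last by move=> j; rewrite integral_wasserstein.
rewrite integral_wasserstein lee_fin.
(* The tower property as a sum: averaging over the last draw gives [mean_step], to which the
   one-step bound applies history by history. *)
apply: (@le_trans _ _ (\sum_(h : history k) p ^+ k * mean_step i h)%R).
  rewrite le_eqVlt; apply/orP; left; apply/eqP.
  rewrite (sum_historyS predT).
  apply: eq_bigr => h _; rewrite mulr_sumr; apply: eq_bigr => i' _.
  by rewrite mulrA exprSr.
under [leRHS]eq_bigr do rewrite integral_wasserstein /= mulr_sumr.
rewrite exchange_big/=; apply: ler_sum => h _.
under [leRHS]eq_bigr do rewrite mulrCA.
by rewrite -mulr_sumr ler_wpM2l ?exprn_ge0 ?(ltW p_gt0)// mean_step_le.
Qed.

End RandomScanCavi.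

Theorem proposition19 (R : realType) (n d : nat) (tau : R)
    (e : rel 'I_n) (J : 'I_n -> 'I_n -> R)
    (e_sym : symmetric e) (e_irr : irreflexive e)
    (tau_gt0 : 0 < tau)
    (J_sym : forall i j, e i j -> J i j = J j i)
    (J_gt0 : forall i j, e i j -> 0 < J i j) :
  let Rpar := influence_mx tau e J in
  let Rseq := sequential_mx tau e J in
  let Rrs := random_scan_mx tau e J in
  [/\ spectral_radius Rseq < 1, spectral_radius Rrs < 1
    & spectral_radius Rpar < 1] /\
  exists mus : 'I_n -> probability (euclid R d) R,
    [/\ cavi_fixed_point tau e J mus,
        forall nu : 'I_n -> probability (euclid R d) R,
          cavi_fixed_point tau e J nu -> forall i, nu i ≡μ mus i &
    [/\
      (* sequential *)
      forall mu : nat -> 'I_n -> probability (euclid R d) R,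
        (forall i, admissible_factor (mu 0%N i)) ->
        sequential_cavi tau e J mu ->
        (forall k, lee_vec (wasserstein_vec (mu k.+1) mus)
                           (emulmx Rseq (wasserstein_vec (mu k) mus))) /\
        converges_at_rate (spectral_radius Rseq)
          (fun k => wasserstein_vec (mu k) mus),
      (* random scan *)
      forall (dO : measure_display) (Omega : measurableType dO)
          (P : probability Omega R) (I : nat -> Omega -> 'I_n)
          (mu0 : 'I_n -> probability (euclid R d) R)
          (mu : nat -> Omega -> 'I_n -> probability (euclid R d) R),
        uniform_draws P I -> independent_draws P I ->
        (forall i, admissible_factor (mu0 i)) ->
        random_scan_cavi tau e J I mu0 mu ->
        (forall k i,
          let X := fun om => wasserstein_vec (mu k.+1 om) mus i in
          (exists Y, is_cond_expectation P (sigma_factors (mu k)) X Y) /\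
          forall Y, is_cond_expectation P (sigma_factors (mu k)) X Y ->
            {ae P, forall om,
              (Y om <= emulmx Rrs (wasserstein_vec (mu k om) mus) i)%E}) /\
        converges_at_rate (spectral_radius Rrs)
          (fun k i => \int[P]_om wasserstein_vec (mu k om) mus i)%E
      (* parallel *)
    & forall mu : nat -> 'I_n -> probability (euclid R d) R,
        (forall i, admissible_factor (mu 0%N i)) ->
        parallel_cavi tau e J mu ->
        (forall k, lee_vec (wasserstein_vec (mu k.+1) mus)
                           (emulmx Rpar (wasserstein_vec (mu k) mus))) /\
        converges_at_rate (spectral_radius Rpar)
          (fun k => wasserstein_vec (mu k) mus)]].
Proof.
move=> Rpar Rseq Rrs; split.
  split; first exact: spectral_radius_sequential.
    exact: spectral_radius_random_scan.
  exact: spectral_radius_influence.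
have [mus musP] := choice (fun i =>
  is_gaussian_exists (d := d) (precision_gt0 tau_gt0 J_gt0 i)).
exists mus; split.
- exact: (cavi_fixed_point_mus tau_gt0 J_gt0 musP).
- move=> nu nuP i; exact: (cavi_fixed_point_unique tau_gt0 J_gt0 musP nuP).
split.
- move=> mu mu0 muP.
  exact: (sequential_cavi_converges tau_gt0 J_gt0 musP e_irr mu0 muP).
- move=> dO Omega P I mu0 mu I_unif I_indep mu0_adm muP; split.
    move=> k i X.
    exact: (random_scan_conditional tau_gt0 J_gt0 musP I_unif I_indep mu0_adm muP).
  exact: (random_scan_rate tau_gt0 J_gt0 musP I_unif I_indep mu0_adm muP).
- move=> mu mu0 muP.
  exact: (parallel_cavi_converges tau_gt0 J_gt0 musP mu0 muP).
Qed.
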